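(* Let $H$ be a transfer Krull monoid over an abelian group $G$. 1. $\mathsf{hf}(H)<\infty$ if and only if $\exp(G)<\infty$. 2. If $\exp(G)<\infty$ and $|G|\ge 3$, then $\exp(G)\le \mathsf{hf}(H)\le \frac{3}{2}(\exp(G)-1)$. 3. If $G$ is cyclic or $\exp(G)\le 6$, then $\mathsf{hf}(H)=\exp(G)$.
   Context: Monoids. A monoid is an associative semigroup with identity, written multiplicatively; $H^\times$ is the group of units of $H$. $H$ is unit-cancellative if $au=a$ or $ua=a$ implies $u\in H^\times$; monoids here are assumed unit-cancellative. An atom is a non-unit $u\in H$ such that $u=ab$ implies $a\in H^\times$ or $b\in H^\times$; $\mathcal A(H)$ is the set of atoms. For a non-unit $a$, $\mathsf L(a)=\mathsf L_H(a)$ is the set of all $k\in\mathbb N=\{1,2,\dots\}$ such that $a$ is a product of $k$ atoms of $H$; for $a\in H^\times$ set $\mathsf L(a)=\{0\}$. $H$ is half-factorial if $|\mathsf L(a)|=1$ for all $a\in H$. For $a\in H$, $\llbracket a\rrbracket=\{b\in H : b \text{ divides some power of } a\}$ denotes the smallest divisor-closed submonoid of $H$ containing $a$. The half-factoriality index $\mathsf{hf}(H)$ is the infimum (with $\inf\emptyset=\infty$) of all $N\in\mathbb N$ with the property: if $a\in H$ and $|\mathsf L(a^N)|=1$, then $\llbracket a\rrbracket$ is half-factorial. Zero-sum sequences. For a non-empty subset $G_0$ of an additive abelian group $G$, $\mathcal F(G_0)$ is the free abelian monoid (written multiplicatively) with basis $G_0$; its elements are called sequences over $G_0$. For $S=g_1\cdots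 g_\ell\in\mathcal F(G_0)$, $\sigma(S)=g_1+\dots+g_\ell\in G$. $\mathcal B(G_0)=\{S\in\mathcal F(G_0):\sigma(S)=0\}$ is the monoid of zero-sum sequences over $G_0$; it is reduced (its only unit is the empty sequence). Transfer Krull monoids. $H$ is a transfer Krull monoid over $G_0$ if there is a weak transfer homomorphism $\theta\colon H\to\mathcal B(G_0)$, i.e. a monoid homomorphism that is surjective, satisfies $\theta^{-1}(\{1\})=H^\times$, and such that whenever $a\in H$, $n\in\mathbb N$ and $\theta(a)=v_1\cdots v_n$ with $v_1,\dots,v_n\in\mathcal A(\mathcal B(G_0))$, there exist $u_1,\dots,u_n\in\mathcal A(H)$ and a permutation $\tau$ of $\{1,\dots,n\}$ with $a=u_1\cdots u_n$ and $\theta(u_i)=v_{\tau(i)}$ for all $i$. ''Over the abelian group $G$'' means $G_0=G$. $\exp(G)$ is the least common multiple of the orders of all elements of $G$, with $\exp(G)=\infty$ if $G$ has an element of infinite order or the orders are unbounded.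
   Formalization: The upper bound in part 2 is claimed only when exp(G) ≠ 2 (for exp(G) = 2 it would read 2 ≤ hf(H) ≤ 3/2), and part 3 excludes |G| = 2, where hf(H) = 1 but exp(G) = 2. *)

(* Defs.v *)
From HB Require Import structures.
From mathcomp Require Import all_boot all_order all_algebra perm finmap multiset.
From mathcomp Require Import boolp classical_sets cardinality.
From mathcomp Require Import constructive_ereal ereal.

Set Implicit Arguments.
Unset Strict Implicit.
Unset Printing Implicit Defensive.

Import Order.TTheory GRing.Theory Num.Theory.

Local Open Scope classical_set_scope.
Local Open Scope card_scope.
Local Open Scope group_scope.

(* Infimum in the extended numbers of a set of naturals; the infimum of the
   empty set is +oo. *)
Definition natinf (A : set nat) : \bar rat :=
  ereal_inf [set (n%:R%R)%:E | n in A].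

Lemma natinf0 : natinf set0 = +oo%E.
Proof. by rewrite /natinf image_set0 ereal_inf0. Qed.

Lemma natinf_min (A : set nat) n :
  A n -> (forall m, A m -> (n <= m)%N) -> natinf A = (n%:R%R)%:E.
Proof.
move=> An Amin; rewrite /natinf /ereal_inf /ereal_sup /supremum.
set B := (X in if X == set0 then _ else _).
have Bn : B (- (n%:R%R)%:E)%E by exists (n%:R%R)%:E => //; exists n.
have supB : supremums B (- (n%:R%R)%:E)%E.
  split => [_ [_ [m Am <-] <-]|y]; last exact.
  by rewrite leeN2 lee_fin ler_nat Amin.
case: eqP => [B0|_]; first by rewrite B0 in Bn.
case: xgetP => [y _ supBy|/(_ _ supB)//].
by rewrite (is_subset1_supremums supBy supB) oppeK.
Qed.

(* Factorizations in a submonoid S of M: units, atoms and sets of lengths are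
   those of the monoid S, so that S = setT gives those of M itself. *)
Section Factorizations.
Variable M : monoidType.
Implicit Types (S : set M) (a b u : M).

Definition units S : set M :=
  [set u | S u /\ exists v, [/\ S v, u * v = 1 & v * u = 1]].

Definition unit_cancellative : Prop :=
  forall a u, a * u = a \/ u * a = a -> units setT u.

Definition atoms S : set M :=
  [set u | [/\ S u, ~ units S u &
    forall a b, S a -> S b -> u = a * b -> units S a \/ units S b]].

Definition lengths S a : set nat :=
  [set k | (units S a /\ k = 0) \/
    [/\ ~ units S a, (0 < k)%N &
     exists u : 'I_k -> M, (forall i, atoms S (u i)) /\ a = \prod_(i < k) u i]].

Definition single_length S a : Prop := lengths S a #= `I_1.

Definition half_factorial S : Prop := forall a, S a -> single_length S a.

(* M need not be commutative: b divides c when c lies in M b M. *)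
Definition divides b c : Prop := exists x y, c = x * b * y.

Definition divisor_closure a : set M := [set b | exists n, divides b (a ^+ n)].

Lemma divisor_closure_divides a b c :
  divides b c -> divisor_closure a c -> divisor_closure a b.
Proof.
move=> [x [y ->]] [n [x' [y' an]]]; exists n, (x' * x), (y * y').
by rewrite an !mulgA.
Qed.

Lemma divisor_closure_smallest a (S : set M) :
  S 1 -> (forall b c, S b -> S c -> S (b * c)) ->
  (forall b c, divides b c -> S c -> S b) -> S a -> divisor_closure a `<=` S.
Proof.
move=> S1 SM Sdiv Sa b [n bn]; apply: Sdiv bn _.
by elim: n => [|n IHn]; rewrite ?expg0 // expgS; apply: SM.
Qed.

Lemma divisor_closureM a b c : (forall x y : M, x * y = y * x) ->
  divisor_closure a b -> divisor_closure a c -> divisor_closure a (b * c).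
Proof.
move=> mulC [n [x [y an]]] [m [z [w am]]]; exists (n + m)%N, (x * y), (z * w).
rewrite expgnDr an am -[x * b * y]mulgA [b * y]mulC !mulgA.
by rewrite -!mulgA; congr (_ * (_ * (_ * _))); rewrite !mulgA [z * c]mulC.
Qed.

Definition hf : \bar rat :=
  natinf [set N | (0 < N)%N /\
    forall a, single_length setT (a ^+ N) -> half_factorial (divisor_closure a)].

End Factorizations.

Arguments unit_cancellative : clear implicits.
Arguments hf : clear implicits.

(* The free abelian monoid with basis T, written multiplicatively: finite
   multisets, with multiset sum as product. *)
Definition free_monoid (T : choiceType) : Type := {mset T}%mset.

HB.instance Definition _ (T : choiceType) := Choice.on (free_monoid T).
HB.instance Definition _ (T : choiceType) :=
  isMonoid.Build (free_monoid T) (@msetDA T) (@mset0D T) (@msetD0 T).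

Section ZeroSum.
Variable G : zmodType.
Implicit Types S : free_monoid G.

Definition sigma S : G := (\sum_(g <- (S : {mset G}%mset)) g)%R.

Definition zero_sum (G0 : set G) : set (free_monoid G) :=
  [set S | (forall g, g \in (S : {mset G}%mset) -> G0 g) /\ sigma S = 0%R].

Definition weak_transfer (H : monoidType) (G0 : set G) (theta : H -> free_monoid G) :=
  [/\ monoid.monoid_morphism theta,
      range theta = zero_sum G0,
      theta @^-1` [set 1] = units setT &
      forall (a : H) (n : nat) (v : 'I_n -> free_monoid G),
        (0 < n)%N -> (forall i, atoms (zero_sum G0) (v i)) ->
        theta a = \prod_(i < n) v i ->
        exists (u : 'I_n -> H) (tau : {perm 'I_n}),
          [/\ forall i, atoms setT (u i), a = \prod_(i < n) u i &
              forall i, theta (u i) = v (tau i)]].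

Definition transfer_krull (H : monoidType) (G0 : set G) : Prop :=
  exists theta : H -> free_monoid G, weak_transfer G0 theta.

Definition has_order (g : G) (k : nat) : Prop :=
  [/\ (0 < k)%N, (g *+ k = 0)%R &
      forall j, (0 < j)%N -> (g *+ j = 0)%R -> (k <= j)%N].

(* The least common multiple of the orders; +oo when there is no common
   multiple, in particular when some element has infinite order. *)
Definition exponent : \bar rat :=
  natinf [set n | (0 < n)%N /\ forall g, exists2 k, has_order g k & (k %| n)%N].

Definition is_cyclic : Prop := exists g : G, forall x, exists k : int, x = (g *~ k)%R.

End ZeroSum.

Arguments exponent : clear implicits.
Arguments is_cyclic : clear implicits.

(* Main.v *)
Require Import Defs.
From mathcomp Require Import all_boot all_order all_algebra.
From mathcomp Require Import boolp classical_sets cardinality.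
From mathcomp Require Import constructive_ereal ereal.
From mathcomp Require Import finmap multiset zify ring.

(* Factorization lengths in [H] are those of the images in [B(G)], so [hf H] is
   the least [N > 0] such that, for every zero-sum [A], uniqueness of the length
   of [A^N] forces it for all powers of [A].

   Upper bounds. Let [A^N] have a unique length, [N >= n = exp G], and let [V] be
   an atom over the support of [A] of minimal cross number k(V), with k(V) < 1.
   Every multiplicity in [V] is less than half the order of the element:
   otherwise [g^(ord g)] splits off from [V^2] and leaves cross number
   2 k(V) - 1 < k(V). Hence, for [N = floor(3(n-1)/2)], if [W] is obtained from
   [V^j] by removing all blocks [g^(ord g)], then [W V] divides [A^N]. Comparing
   lengths for j = 0, ..., n - 1 gives k(V) = 1, a contradiction. So all cross
   numbers are at least 1, and replacing the multiplicities [v_g] by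
   [ord g - v_g] shows that they equal 1, which yields half-factoriality. For
   [n <= 6] (with an extra argument when [n = 5]) and for cyclic [G] the same
   works with [N = n].

   Lower bounds come from [A = g(-g)] with [ord g = n], from [A = gh(g+h)] when
   [n = 2], and from [A = e(-e)f(-f)] with [f = (N+1)e] when orders are
   unbounded. *)

Set Implicit Arguments.
Unset Strict Implicit.
Unset Printing Implicit Defensive.

Import GRing.Theory Num.Theory.

(** * Sequences *)

Section Sequences.
Variable G : zmodType.
Notation F := (free_monoid G).
Implicit Types (X Y Z U V W : F) (g h : G) (D : seq G).

Definition mult X g : nat := (X : {mset G}%mset) g.

Lemma multP X Y : mult X =1 mult Y -> X = Y.
Proof. by move=> eqXY; apply/msetP. Qed.

Lemma mult1 g : mult 1%g g = 0.
Proof. exact: mset0E. Qed.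

Lemma multM X Y g : mult (X * Y)%g g = mult X g + mult Y g.
Proof. by rewrite /mult msetE2. Qed.

Lemma multX X n g : mult (X ^+ n)%g g = n * mult X g.
Proof. by elim: n => [|n IHn]; rewrite ?expg0 ?mult1// expgS multM IHn mulSn. Qed.

Lemma mult_prod I (r : seq I) (f : I -> F) g :
  mult (\prod_(i <- r) f i)%g g = \sum_(i <- r) mult (f i) g.
Proof. by apply: (big_morph (mult^~ g)) => [X Y|]; rewrite ?multM ?mult1. Qed.

Definition pw g n : F := msetn n g.

Lemma mult_pw g n h : mult (pw g n) h = if h == g then n else 0.
Proof. exact: msetnE. Qed.

Lemma mult_prod_pw D (w : G -> nat) g : uniq D ->
  mult (\prod_(h <- D) pw h (w h))%g g = if g \in D then w g else 0.
Proof.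
move=> uD; rewrite mult_prod; case: ifP => [gD|/negbT gD].
  rewrite (bigD1_seq g)//= mult_pw eqxx big1 ?addn0// => h /negPf hg.
  by rewrite mult_pw eq_sym hg.
rewrite big_seq big1// => h hD; rewrite mult_pw; case: eqP => // gh.
by rewrite gh hD in gD.
Qed.

Lemma seq_mul_eq1 X Y : (X * Y = 1 -> X = 1)%g.
Proof.
move=> XY1; apply: multP => g; have := multM X Y g.
by rewrite XY1 !mult1 => /esym/eqP; rewrite addn_eq0 => /andP[/eqP->].
Qed.

Definition seq_dvd X Y := forall g, mult X g <= mult Y g.

Lemma seq_dvdP X Y : seq_dvd X Y -> exists Z, Y = (X * Z)%g.
Proof.
move=> XY; exists (msetB Y X); apply: multP => g.
by rewrite multM /mult msetE2 subnKC//; apply: XY.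
Qed.

Definition supp X : seq G := finsupp (X : {mset G}%mset).

Lemma supp_uniq X : uniq (supp X). Proof. exact: fset_uniq. Qed.

Lemma mem_supp X g : (g \in supp X) = (0 < mult X g).
Proof. by rewrite lt0n mem_finsupp. Qed.

Lemma seq_eq_prod_pw X D : uniq D -> {subset supp X <= D} ->
  X = (\prod_(g <- D) pw g (mult X g))%g.
Proof.
move=> uD sXD; apply: multP => g; rewrite mult_prod_pw//.
by case: ifP => // /negbT; apply: contraNeq; rewrite -lt0n -mem_supp => /sXD.
Qed.

Lemma big_seqM (R : Type) (idx : R) (op : Monoid.com_law idx) (f : G -> R) X Y :
  \big[op/idx]_(g <- ((X * Y)%g : {mset G}%mset)) f g =
  op (\big[op/idx]_(g <- (X : {mset G}%mset)) f g)
     (\big[op/idx]_(g <- (Y : {mset G}%mset)) f g).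
Proof.
rewrite -big_cat; apply: perm_big; apply/allP => g _ /=.
by rewrite count_cat !count_mem_mset msetE2.
Qed.

Lemma sigma1 : sigma (1%g : F) = 0%R.
Proof. by rewrite /sigma big_mset0. Qed.

Lemma sigmaM X Y : sigma (X * Y)%g = (sigma X + sigma Y)%R.
Proof. exact: big_seqM. Qed.

Lemma sigma_pw g n : sigma (pw g n) = (g *+ n)%R.
Proof.
by rewrite /sigma big_msetn Monoid.iteropE; elim: n => //= n ->; rewrite mulrS.
Qed.

Lemma sigmaX X n : sigma (X ^+ n)%g = (sigma X *+ n)%R.
Proof. by elim: n => [|n IHn]; rewrite ?expg0 ?sigma1// expgS sigmaM IHn mulrS. Qed.

Lemma sigma_prod I (r : seq I) (f : I -> F) :
  sigma (\prod_(i <- r) f i)%g = (\sum_(i <- r) sigma (f i))%R.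
Proof. by apply: big_morph => [X Y|]; rewrite ?sigmaM ?sigma1. Qed.

Lemma sigma_supp X D : uniq D -> {subset supp X <= D} ->
  sigma X = (\sum_(g <- D) g *+ mult X g)%R.
Proof.
move=> uD sXD; rewrite {1}(seq_eq_prod_pw uD sXD) sigma_prod.
by apply: eq_bigr => g _; rewrite sigma_pw.
Qed.

Definition weight (c : G -> nat) X := \sum_(g <- (X : {mset G}%mset)) c g.

Lemma weight1 c : weight c 1%g = 0.
Proof. by rewrite /weight big_mset0. Qed.

Lemma weightM c X Y : weight c (X * Y)%g = weight c X + weight c Y.
Proof. exact: big_seqM. Qed.

Lemma weight_pw c g n : weight c (pw g n) = n * c g.
Proof.
by rewrite /weight big_msetn Monoid.iteropE; elim: n => //= n ->; rewrite mulSn.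
Qed.

Lemma weight_prod c I (r : seq I) (f : I -> F) :
  weight c (\prod_(i <- r) f i)%g = \sum_(i <- r) weight c (f i).
Proof. by apply: big_morph => [X Y|]; rewrite ?weightM ?weight1. Qed.

Lemma weight_supp c X D : uniq D -> {subset supp X <= D} ->
  weight c X = \sum_(g <- D) mult X g * c g.
Proof.
move=> uD sXD; rewrite {1}(seq_eq_prod_pw uD sXD) weight_prod.
by apply: eq_bigr => g _; rewrite weight_pw.
Qed.

Lemma weight_dvd c X Y : seq_dvd X Y -> weight c X <= weight c Y.
Proof. by case/seq_dvdP => Z ->; rewrite weightM leq_addr. Qed.

Lemma weight_eq0 c X : (forall g, 0 < c g) -> weight c X = 0 -> X = 1%g.
Proof.
move=> c_gt0; rewrite (weight_supp c (supp_uniq X)) // => /eqP.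
rewrite sum_nat_seq_eq0 => /allP X0; apply: multP => g; rewrite mult1.
case: (posnP (mult X g)) => // gX; have := X0 g; rewrite mem_supp => /(_ gX).
by rewrite /= muln_eq0 !eqn0Ngt gX c_gt0.
Qed.

(** * Factorizations of zero-sum sequences *)

Definition atom := atoms (zero_sum [set: G]).

Lemma zero_sumT X : zero_sum [set: G] X <-> sigma X = 0%R.
Proof. by split=> [[]|X0]; last split. Qed.

Lemma units_zero_sum X : units (zero_sum [set: G]) X <-> X = 1%g.
Proof.
split=> [[_ [Y [_ XY1 _]]]|->]; first exact: seq_mul_eq1 XY1.
by split; [exact/zero_sumT/sigma1 | exists 1%g; split; rewrite ?mulg1//;
  exact/zero_sumT/sigma1].
Qed.

Lemma atomP U : atom U <-> [/\ sigma U = 0%R, U <> 1%g &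
  forall X Y, sigma X = 0%R -> sigma Y = 0%R -> U = (X * Y)%g ->
    X = 1%g \/ Y = 1%g].
Proof.
split=> [[/zero_sumT U0 nU1 irrU]|[U0 nU1 irrU]].
  split=> [//|U1|X Y /zero_sumT X0 /zero_sumT Y0 /(irrU _ _ X0 Y0)].
    by apply/nU1/units_zero_sum.
  by case=> /units_zero_sum; [left|right].
split=> [|/units_zero_sum//|X Y /zero_sumT X0 /zero_sumT Y0 UE].
  exact/zero_sumT.
by case: (irrU X Y X0 Y0 UE) => ->; [left|right]; apply/units_zero_sum.
Qed.

(** The empty list is allowed, so [1] has length 0 without a separate case for units. *)
Definition factors X k :=
  exists s : seq F, [/\ forall U, U \in s -> atom U, size s = k &
                        X = (\prod_(U <- s) U)%g].

Lemma factors1 : factors 1%g 0.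
Proof. by exists [::]; split=> //; rewrite big_nil. Qed.

Lemma factors_atom U : atom U -> factors U 1.
Proof.
by move=> aU; exists [:: U]; split=> [V||]; rewrite ?inE ?big_seq1// => /eqP->.
Qed.

Lemma factorsM X Y k l : factors X k -> factors Y l -> factors (X * Y)%g (k + l).
Proof.
move=> [s [as_ <- ->]] [t [at_ <- ->]]; exists (s ++ t).
split=> [U||]; rewrite ?size_cat ?big_cat// mem_cat.
by case/orP; [apply: as_ | apply: at_].
Qed.

Lemma factorsX X k n : factors X k -> factors (X ^+ n)%g (n * k).
Proof.
move=> Xk; elim: n => [|n IHn]; first by rewrite expg0; apply: factors1.
by rewrite expgS mulSn; apply: factorsM.
Qed.

Lemma factors_prod I (r : seq I) (f : I -> F) (k : I -> nat) :
  (forall i, factors (f i) (k i)) ->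
  factors (\prod_(i <- r) f i)%g (\sum_(i <- r) k i).
Proof.
move=> fk; elim: r => [|i r IHr]; first by rewrite !big_nil; apply: factors1.
by rewrite !big_cons; apply: factorsM.
Qed.

Lemma factors_sigma X k : factors X k -> sigma X = 0%R.
Proof.
case=> s [as_ _ ->]; rewrite sigma_prod big_seq big1// => U /as_.
by case/atomP.
Qed.

Lemma atom_dvd_prod (s : seq F) U : U \in s -> seq_dvd U (\prod_(V <- s) V)%g.
Proof.
move=> Us g; rewrite mult_prod (big_rem U)//=; exact: leq_addr.
Qed.

(** Every factor of [X] divides [X]. Bounding only such atoms lets the lemma apply to bounds known
    just over the support of a given sequence. *)
Lemma factors_weight_ge c d X k :
  (forall U, atom U -> seq_dvd U X -> d <= weight c U) ->
  factors X k -> k * d <= weight c X.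
Proof.
move=> dU [s [as_ <- XE]]; rewrite XE weight_prod -sum1_size big_distrl /=.
rewrite big_seq [X in _ <= X]big_seq leq_sum// => U Us; rewrite mul1n.
by apply: dU; [apply: as_ | rewrite XE; apply: atom_dvd_prod].
Qed.

Lemma factors_weight c d X k :
  (forall U, atom U -> seq_dvd U X -> weight c U = d) ->
  factors X k -> weight c X = k * d.
Proof.
move=> dU [s [as_ <- XE]]; rewrite XE weight_prod -sum1_size big_distrl /=.
rewrite big_seq [in RHS]big_seq; apply: eq_bigr => U Us; rewrite mul1n.
by apply: dU; [apply: as_ | rewrite XE; apply: atom_dvd_prod].
Qed.

Lemma atom_weight_gt0 c U : (forall g, 0 < c g) -> atom U -> 0 < weight c U.
Proof.
move=> c_gt0 /atomP[_ nU1 _]; rewrite lt0n; apply: contra_notN nU1 => /eqP.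
exact: weight_eq0.
Qed.

Lemma factors_eq1 k : factors 1%g k -> k = 0.
Proof.
move/(factors_weight_ge (c := fun=> 1) (d := 1)); rewrite weight1 muln1 leqn0.
by move=> /(_ _)/eqP; apply=> U aU _; apply: atom_weight_gt0.
Qed.

Lemma factors_gt0 X k : X <> 1%g -> factors X k -> 0 < k.
Proof.
move=> nX1 [s [_ <- XE]]; case: s XE => // XE.
by case: nX1; rewrite XE big_nil.
Qed.

Lemma factors1_atom X : factors X 1 -> atom X.
Proof.
case=> s [+ + ->]; case: s => [|U []]// aU _; rewrite big_seq1; apply: aU.
exact: mem_head.
Qed.

(** Induction on the length: a nontrivial non-atom is a product of two shorter zero-sum
    sequences. *)
Lemma factors_exists X : sigma X = 0%R -> exists k, factors X k.
Proof.
have [n] := ubnP (weight (fun=> 1) X); elim: n X => // n IHn X ltXn X0.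
have [->|/eqP nX1] := eqVneq X 1%g; first by exists 0; apply: factors1.
have [aX|naX] := pselect (atom X); first by exists 1; apply: factors_atom.
have [Y [Z [Y0 Z0 XE [nY1 nZ1]]]] : exists Y Z, [/\ sigma Y = 0%R,
    sigma Z = 0%R, X = (Y * Z)%g & Y <> 1%g /\ Z <> 1%g].
  apply: contra_notP naX => nYZ; apply/atomP; split=> // Y Z Y0 Z0 XE.
  by apply: contrapT => /not_orP YZ1; apply: nYZ; exists Y, Z.
have pos W : W <> 1%g -> 0 < weight (fun=> 1) W.
  by move=> nW1; rewrite lt0n; apply: contra_notN nW1 => /eqP; apply: weight_eq0.
have := pos _ nY1; have := pos _ nZ1; move: ltXn; rewrite XE weightM => *.
have [||k Yk] := IHn Y => //; first by lia.
have [||l Zl] := IHn Z => //; first by lia.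
by exists (k + l); apply: factorsM.
Qed.

Definition unique_length X := forall k l, factors X k -> factors X l -> k = l.

(** Two factorizations of [X], both multiplied by one fixed factorization of the zero-sum cofactor,
    become factorizations of [Y]. *)
Lemma unique_length_dvd X Y : sigma X = 0%R -> sigma Y = 0%R ->
  seq_dvd X Y -> unique_length Y -> unique_length X.
Proof.
move=> X0 + /seq_dvdP[Z YE]; rewrite YE sigmaM X0 add0r => Z0 uY k l Xk Xl.
have [m Zm] := factors_exists Z0; apply: (@addIn m).
by apply: uY; apply: factorsM.
Qed.

Lemma atom_dvd_exists X : sigma X = 0%R -> X <> 1%g ->
  exists2 U, atom U & seq_dvd U X.
Proof.
move=> X0 nX1; have [k Xk] := factors_exists X0.
have := factors_gt0 nX1 Xk; case: Xk => s [+ <- XE]; case: s XE => // U s XE as_ _.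
exists U; first by apply: as_; apply: mem_head.
by rewrite XE; apply/atom_dvd_prod/mem_head.
Qed.

Lemma unique_lengthX_le X m n : sigma X = 0%R -> m <= n ->
  unique_length (X ^+ n)%g -> unique_length (X ^+ m)%g.
Proof.
move=> X0 lemn; apply: unique_length_dvd; rewrite ?sigmaX ?X0 ?mul0rn//.
by move=> g; rewrite !multX leq_mul2r lemn orbT.
Qed.

End Sequences.

Arguments mult {G} X%_g g%_R.
Arguments pw {G} g%_R n%_N.
Arguments seq_dvd {G} X%_g Y%_g.
Arguments factors {G} X%_g k%_N.
Arguments unique_length {G} X%_g.
Arguments weight {G} c X%_g.
Arguments supp {G} X%_g.

(** * Orders of elements *)

Section Orders.
Variable G : zmodType.
Implicit Types (g h : G) (X Y Z : free_monoid G).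

(* [zorder g = 0] encodes an element of infinite order. *)
Definition zorder g : nat :=
  if pselect (exists k, (0 < k) && (g *+ k == 0)%R) is left ex then ex_minn ex
  else 0.

Lemma zorder_dvd g k : (g *+ k == 0)%R = (zorder g %| k).
Proof.
rewrite /zorder; case: pselect => [ex|nex]; last first.
  rewrite dvd0n; case: k => [|k]; first by rewrite mulr0n !eqxx.
  by apply/negP => gk; apply: nex; exists k.+1.
case: ex_minnP => m /andP[m_gt0 /eqP gm] min_m.
have gmod : (g *+ k = g *+ (k %% m))%R.
  by rewrite {1}(divn_eq k m) mulrnDr mulnC mulrnA gm mul0rn add0r.
apply/idP/idP => [gk|/dvdnP[q ->]]; last by rewrite mulnC mulrnA gm mul0rn.
rewrite /dvdn; apply: contraT; rewrite -lt0n => r_gt0.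
have := min_m (k %% m); rewrite r_gt0 -gmod gk => /(_ isT).
by rewrite leqNgt ltn_mod m_gt0.
Qed.

Lemma mulrn_zorder g : (g *+ zorder g = 0)%R.
Proof. by apply/eqP; rewrite zorder_dvd. Qed.

Lemma mulrn_mod_zorder g k : (g *+ (k %% zorder g) = g *+ k)%R.
Proof.
by rewrite {2}(divn_eq k (zorder g)) mulrnDr mulnC mulrnA mulrn_zorder mul0rn add0r.
Qed.

Lemma zorder_unique g m : (forall k, (g *+ k == 0)%R = (m %| k)) -> zorder g = m.
Proof.
by move=> gm; apply/eqP; rewrite eqn_dvd -zorder_dvd gm dvdnn -gm mulrn_zorder /=.
Qed.

Lemma zorder_mulrn g a b : 0 < a -> zorder g = a * b -> zorder (g *+ a)%R = b.
Proof.
move=> a_gt0 gab; apply: zorder_unique => k.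
by rewrite -mulrnA zorder_dvd gab dvdn_pmul2l.
Qed.

(** If [k (g + h) = 0], multiplying by [ord h] kills the part of [h] and leaves [ord g] dividing
    [k * ord h]; coprimality removes [ord h]. The other divisibility is symmetric. *)
Lemma zorder_coprimeD g h : coprime (zorder g) (zorder h) ->
  zorder (g + h)%R = zorder g * zorder h.
Proof.
move=> co_gh; apply: zorder_unique => k; rewrite Gauss_dvd// mulrnDl.
apply/idP/andP => [/eqP ghk|[]]; last first.
  by rewrite -!zorder_dvd => /eqP-> /eqP->; rewrite addr0.
split.
  rewrite -(@Gauss_dvdr _ (zorder h))// -zorder_dvd.
  have /(congr1 (fun z => z *+ zorder h)%R) := ghk.
  rewrite mul0rn mulrnDl -!mulrnA [k * _]mulnC [(h *+ _)%R]mulrnA mulrn_zorder.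
  by rewrite mul0rn addr0 => /eqP.
rewrite -(@Gauss_dvdr _ (zorder g)) 1?coprime_sym// -zorder_dvd.
have /(congr1 (fun z => z *+ zorder g)%R) := ghk.
rewrite mul0rn mulrnDl -!mulrnA [k * _]mulnC [(g *+ _)%R]mulrnA mulrn_zorder.
by rewrite mul0rn add0r => /eqP.
Qed.

Definition annihilator n := 0 < n /\ forall g, (g *+ n = 0)%R.

Lemma annihilator_dvd n g : annihilator n -> zorder g %| n.
Proof. by case=> _ ng; rewrite -zorder_dvd ng. Qed.

Lemma annihilator_zorder_gt0 n g : annihilator n -> 0 < zorder g.
Proof. by move=> an; apply: dvdn_gt0 (annihilator_dvd g an); case: an. Qed.

(* An element of maximal order: a prime power dividing the order of some [h]
   to a larger extent could be traded in, giving a larger order. *)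
Lemma exists_zorder_annihilator n : annihilator n ->
  exists g, annihilator (zorder g).
Proof.
move=> an; pose P k := `[< exists g, zorder g = k >].
have Pub k : P k -> k <= n.
  move=> /asboolP[g <-]; apply: dvdn_leq; first by case: an.
  exact: annihilator_dvd.
have exP : exists k, P k by exists (zorder (0%R : G)); apply/asboolP; exists 0%R.
case: (ex_maxnP exP Pub) => m /asboolP[g gm] max_m.
have m_gt0 : 0 < m by rewrite -gm; apply: annihilator_zorder_gt0 an.
exists g; split=> [|h]; first by rewrite gm.
apply/eqP; rewrite zorder_dvd gm; set o := zorder h.
have o_gt0 : 0 < o by apply: annihilator_zorder_gt0 an.
apply/dvdn_partP => // p; rewrite mem_primes => /andP[p_pr _].
rewrite p_part pfactor_dvdn// leqNgt; apply/negP => lt_mo.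
have [m' co_pm' mE] := pfactor_coprime p_pr m_gt0.
have [o' _ oE] := pfactor_coprime p_pr o_gt0.
have g'E : zorder (g *+ p ^ logn p m)%R = m'.
  by apply: zorder_mulrn; rewrite ?expn_gt0 ?prime_gt0// gm mulnC.
have h'E : zorder (h *+ o')%R = p ^ logn p o.
  by apply: zorder_mulrn => //; case: o' oE o_gt0 => // ->.
have : m' * p ^ logn p o <= m.
  apply: max_m; apply/asboolP; exists (g *+ p ^ logn p m + h *+ o')%R.
  by rewrite zorder_coprimeD g'E h'E// coprime_sym coprimeXl.
have m'_gt0 : 0 < m' by case: m' mE m_gt0 {co_pm' g'E} => // ->.
by rewrite {1}mE leq_pmul2l// leq_exp2l ?prime_gt1// leqNgt lt_mo.
Qed.

Lemma sigma_pw_zorder g : sigma (pw g (zorder g)) = 0%R.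
Proof. by rewrite sigma_pw mulrn_zorder. Qed.

(** A zero-sum divisor is a power of [g] whose exponent is a multiple of [ord g], hence trivial or
    everything. *)
Lemma atom_pw_zorder g : 0 < zorder g -> atom (pw g (zorder g)).
Proof.
move=> og_gt0; apply/atomP; split; first exact: sigma_pw_zorder.
  by move/(congr1 (mult^~ g)); rewrite mult_pw eqxx mult1 => og0; rewrite og0 in og_gt0.
move=> X Y X0 Y0 XYE.
have mXY h : mult X h + mult Y h = if h == g then zorder g else 0.
  by rewrite -multM -XYE mult_pw.
have pwE Z : (forall h, h != g -> mult Z h = 0) -> Z = pw g (mult Z g).
  move=> Z0; apply: multP => h; rewrite mult_pw.
  by case: eqP => [->//|/eqP /Z0].
have XE : X = pw g (mult X g).
  by apply: pwE => h /negPf hg; have := mXY h; rewrite hg; lia.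
have YE : Y = pw g (mult Y g).
  by apply: pwE => h /negPf hg; have := mXY h; rewrite hg; lia.
have /eqP := X0; rewrite XE sigma_pw zorder_dvd => /dvdnP[q qE].
have := mXY g; rewrite eqxx; case: q qE => [|q] qE; move=> mg.
  by left; rewrite qE; apply: multP => h; rewrite mult_pw mult1 if_same.
right; rewrite YE (_ : mult Y g = 0).
  by apply: multP => h; rewrite mult_pw mult1 if_same.
by move: mg; rewrite qE mulSn; lia.
Qed.

End Orders.

(** * Cross numbers and half-factoriality *)

Section CrossNumber.
Variables (G : zmodType) (n : nat).
Hypothesis ann : annihilator G n.
Notation F := (free_monoid G).
Notation o := zorder.
Implicit Types (A X Y Z U V : F) (g h : G).

Let n_gt0 : 0 < n. Proof. by case: ann. Qed.
Let o_dvd g : o g %| n. Proof. exact: annihilator_dvd. Qed.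
Let o_gt0 g : 0 < o g. Proof. exact: annihilator_zorder_gt0 ann. Qed.
Let o_le g : o g <= n. Proof. exact: dvdn_leq. Qed.

(* The cross number [\sum_g v_g / ord g], scaled by [n] to be a natural number. *)
Definition cross := weight (fun g : G => n %/ o g).

Lemma cross_coef_gt0 g : 0 < n %/ o g.
Proof. by rewrite divn_gt0. Qed.

Lemma cross_pw g : cross (pw g (o g)) = n.
Proof. by rewrite /cross weight_pw mulnC divnK. Qed.

(** Otherwise the block [g ^ (ord g)] splits off with a nontrivial cofactor. *)
Lemma atom_mult_le V g : atom V -> mult V g <= o g.
Proof.
move=> /atomP[V0 nV1 irrV]; rewrite leqNgt; apply/negP => lt_oV.
have [X VE] : exists X, V = (pw g (o g) * X)%g.
  by apply: seq_dvdP => h; rewrite mult_pw; case: eqP => // ->; apply: ltnW.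
have X0 : sigma X = 0%R by move: V0; rewrite VE sigmaM sigma_pw_zorder add0r.
case: (irrV _ _ (sigma_pw_zorder g) X0 VE) => E1.
  by have /atomP[_ []] := atom_pw_zorder (o_gt0 g).
by move: lt_oV; rewrite VE E1 mulg1 mult_pw eqxx ltnn.
Qed.

Lemma factors_prod_pw_zorder (D : seq G) (c : G -> nat) :
  factors (\prod_(g <- D) pw g (c g * o g))%g (\sum_(g <- D) c g).
Proof.
apply: factors_prod => g; rewrite -[X in factors _ X]muln1.
suff -> : pw g (c g * o g) = (pw g (o g) ^+ c g)%g.
  exact/factorsX/factors_atom/atom_pw_zorder/o_gt0.
by apply: multP => h; rewrite multX !mult_pw; case: ifP => //; rewrite muln0.
Qed.

Lemma mult_prod_supp X (w : G -> nat) g : (mult X g = 0 -> w g = 0) ->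
  mult (\prod_(h <- supp X) pw h (w h))%g g = w g.
Proof.
rewrite mult_prod_pw ?supp_uniq// mem_supp; case: ltnP => //.
by rewrite leqn0 => /eqP-> /(_ erefl).
Qed.

(** This is [V ^ j] after removal of as many blocks [g ^ (ord g)] as possible, which leaves the sum
    unchanged. *)
Definition residue V j : F :=
  (\prod_(g <- supp V) pw g ((j * mult V g) %% o g))%g.

Lemma mult_residue V j g : mult (residue V j) g = (j * mult V g) %% o g.
Proof. by rewrite mult_prod_supp// => ->; rewrite muln0 mod0n. Qed.

Lemma sigma_residue V j : sigma V = 0%R -> sigma (residue V j) = 0%R.
Proof.
move=> V0; rewrite sigma_prod.
transitivity (sigma V *+ j)%R; last by rewrite V0 mul0rn.
rewrite (sigma_supp (supp_uniq V) (fun g => id)) -sumrMnl; apply: eq_bigr => g _.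
by rewrite sigma_pw mulrn_mod_zorder mulnC mulrnA.
Qed.

(* The residues of the powers of [V] all lie below [A ^ N], so that the unique
   length of [residue V j] equals [j] minus the number of blocks [g ^ ord g]
   split off so far. For [j = n] this gives [k(V) = 1]. *)
Lemma cross_of_residue A N V : sigma A = 0%R -> unique_length (A ^+ N) ->
  atom V ->
  (forall j g, (j * mult V g) %% o g + mult V g <= N * mult A g) ->
  cross V = n.
Proof.
move=> A0 uA aV box; have [V0 _ _] := (atomP V).1 aV.
(* The number of blocks [g ^ (ord g)] that become complete when [residue V j] is multiplied by
   [V]. *)
pose c j g := ((j * mult V g) %% o g + mult V g) %/ o g.
have stepE j : (residue V j * V = residue V j.+1 *
    \prod_(g <- supp V) pw g (c j g * o g))%g.
  apply: multP => g; rewrite !multM !mult_residue mult_prod_supp; last first.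
    by rewrite /c => ->; rewrite muln0 mod0n div0n.
  rewrite /c {1}(divn_eq (_ + _) (o g)) addnC; congr (_ + _).
  by rewrite modnDml mulSn addnC.
have dvd_box j : seq_dvd (residue V j * V) (A ^+ N).
  by move=> g; rewrite multM multX mult_residue.
have u_step j : unique_length (residue V j * V).
  apply: unique_length_dvd (dvd_box j) uA; last by rewrite sigmaX A0 mul0rn.
  by rewrite sigmaM sigma_residue// V0 addr0.
(* The sum counts all blocks removed from [V ^ j]. *)
have len j k : factors (residue V j) k ->
    k + \sum_(g <- supp V) (j * mult V g) %/ o g = j.
  elim: j k => [|j IHj] k Wk.
    rewrite big1 => [|g _]; last by rewrite mul0n div0n.
    rewrite addn0; move: Wk; suff -> : residue V 0 = 1%g by apply: factors_eq1.
    by apply: multP => g; rewrite mult_residue mult1 mul0n mod0n.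
  have [l Wl] := factors_exists (sigma_residue j V0).
  have := u_step j _ _ (factorsM Wl (factors_atom aV)).
  rewrite stepE => /(_ _ (factorsM Wk (factors_prod_pw_zorder _ _))) lE.
  have -> : \sum_(g <- supp V) (j.+1 * mult V g) %/ o g =
      \sum_(g <- supp V) c j g + \sum_(g <- supp V) (j * mult V g) %/ o g.
    rewrite -big_split; apply: eq_bigr => g _ /=; rewrite /c mulSn addnC.
    by rewrite {1}(divn_eq (j * mult V g) (o g)) -addnA divnMDl// addnC.
  by rewrite addnA -lE addnAC (IHj _ Wl) addn1.
(* Every [ord g] divides [n], so [V ^ n] consists of blocks only and the number of blocks, which is
   the scaled cross number of [V], equals [n]. *)
have Wn : residue V n = 1%g.
  apply: multP => g; rewrite mult_residue mult1; apply/eqP.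
  exact: dvdn_mulr.
have := len n 0; rewrite Wn add0n => /(_ (factors1 _)) sumE.
rewrite /cross (weight_supp _ (supp_uniq V))// -[RHS]sumE; apply: eq_bigr => g _.
by rewrite -divn_mulAC// mulnC.
Qed.

(** Equivalently, [V] divides some power of [A]. *)
Definition over_supp A V := forall g, 0 < mult V g -> 0 < mult A g.

Lemma minimal_cross_mult V g : atom V -> cross V < n ->
  (forall U, atom U -> over_supp V U -> cross V <= cross U) -> (mult V g).*2 < o g.
Proof.
move=> aV ltVn minV; have [V0 nV1 _] := (atomP V).1 aV.
rewrite ltnNge; apply/negP => le_oV.
have [X VVE] : exists X, (V * V = pw g (o g) * X)%g.
  apply: seq_dvdP => h; rewrite mult_pw multM addnn; case: eqP => // ->//.
have X0 : sigma X = 0%R.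
  by move/(congr1 (@sigma G)): VVE; rewrite !sigmaM V0 sigma_pw_zorder !add0r.
have cX : cross V + cross V = n + cross X.
  have := congr1 cross VVE; rewrite /cross !weightM => ->.
  by rewrite [X in X + _]cross_pw.
(* If [V ^ 2] were the single block [g ^ (ord g)], then [V] would be [g ^ (ord g / 2)], which is not
   zero-sum. *)
have nX1 : X <> 1%g.
  move=> X1; move: VVE; rewrite X1 mulg1 => VVE.
  have vo : (mult V g).*2 = o g.
    by rewrite -addnn -multM VVE mult_pw eqxx.
  have : sigma (pw g (mult V g)) == 0%R.
    rewrite (_ : pw g (mult V g) = V) ?V0//; apply: multP => h.
    rewrite mult_pw; case: eqP => [->//|/eqP/negPf hg].
    by have := multM V V h; rewrite VVE mult_pw hg; lia.
  rewrite sigma_pw zorder_dvd => /dvdnP[q]; have := o_gt0 g.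
  by rewrite -vo; case: q => [|q]; lia.
(* An atom dividing [X] has scaled cross number at most [2 cross V - n], which is below the minimum
   [cross V]. *)
have [U aU UX] := atom_dvd_exists X0 nX1.
have := minV U aU; suff UV : over_supp V U.
  by move/(_ UV); have := weight_dvd (fun g => n %/ o g) UX; rewrite -!/(cross _); lia.
move=> h Uh; have := multM V V h; rewrite VVE multM; have := UX h; lia.
Qed.

(** Complete [V] by [Z] to the product of one block for each element of its support; this product
    divides [A ^ n]. If [Z] has length [k], unique length gives [1 + k] blocks, so
    [cross V + cross Z = (1 + k) n]. All atoms in [Z] weigh at least [n], so [cross Z >= k n] and
    [cross V <= n]. *)
Lemma cross_eq A : sigma A = 0%R -> unique_length (A ^+ n) ->
  (forall U, atom U -> over_supp A U -> n <= cross U) ->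
  forall V, atom V -> over_supp A V -> cross V = n.
Proof.
move=> A0 uA geA V aV oV; apply/eqP; rewrite eqn_leq geA// andbT.
have [V0 _ _] := (atomP V).1 aV.
pose Z := (\prod_(g <- supp V) pw g (o g - mult V g))%g.
have mZ g : 0 < mult V g -> mult Z g = o g - mult V g.
  by move=> Vg; rewrite mult_prod_supp// => E; rewrite E in Vg.
have mZ0 g : mult V g = 0 -> mult Z g = 0.
  by move=> Vg; rewrite mult_prod_pw ?supp_uniq// mem_supp Vg.
have VZE : (V * Z = \prod_(g <- supp V) pw g (1 * o g))%g.
  apply: multP => g; rewrite multM mult_prod_pw ?supp_uniq// mem_supp mul1n.
  case: (posnP (mult V g)) => [Vg|Vg]; first by rewrite Vg mZ0.
  by rewrite mZ// subnKC// atom_mult_le.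
have VZs := factors_prod_pw_zorder (supp V) (fun=> 1); rewrite -VZE in VZs.
have Z0 : sigma Z = 0%R.
  by have := factors_sigma VZs; rewrite sigmaM V0 add0r.
have [k Zk] := factors_exists Z0.
have uVZ : unique_length (V * Z).
  apply: unique_length_dvd uA; rewrite ?sigmaM ?sigmaX ?V0 ?Z0 ?A0 ?mul0rn ?addr0//.
  move=> g; rewrite multM multX.
  case: (posnP (mult V g)) => [Vg|Vg]; first by rewrite Vg mZ0.
  rewrite mZ// subnKC ?atom_mult_le//; have := oV g Vg; have := o_le g.
  by move=> on Ag; apply: leq_trans on _; rewrite leq_pmulr.
have ksE := uVZ _ _ (factorsM (factors_atom aV) Zk) VZs.
have cVZ : cross V + cross Z = (\sum_(g <- supp V) 1) * n.
  rewrite -weightM VZE weight_prod big_distrl; apply: eq_bigr => g _.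
  by rewrite /= !mul1n; apply: cross_pw.
have : k * n <= cross Z.
  apply: factors_weight_ge Zk => U aU UZ; apply: geA => // g Ug.
  case: (posnP (mult V g)) => [Vg|]; last exact: oV.
  by have := UZ g; rewrite mZ0//; lia.
by move: cVZ; rewrite -ksE mulnDl mul1n; lia.
Qed.

(** All atoms that can occur weigh exactly [n], so the weight of a power of [A] determines the
    number of factors. *)
Lemma unique_length_of_cross A :
  (forall U, atom U -> over_supp A U -> cross U = n) ->
  forall m, unique_length (A ^+ m).
Proof.
move=> cA m; have cE k : factors (A ^+ m)%g k -> cross (A ^+ m)%g = k * n.
  apply: factors_weight => U aU UA; apply: cA => // g Ug; have := UA g.
  by rewrite multX; case: (mult A g) => //; lia.
by move=> k l /cE kE /cE; rewrite kE => /eqP; rewrite eqn_pmul2r// => /eqP.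
Qed.

Lemma unique_lengthX A N : sigma A = 0%R -> n <= N -> unique_length (A ^+ N) ->
  (forall V, atom V -> over_supp A V -> cross V < n ->
    (forall g, (mult V g).*2 < o g) -> False) ->
  forall m, unique_length (A ^+ m).
Proof.
move=> A0 nN uA small; apply: unique_length_of_cross; apply: cross_eq => //.
  exact: unique_lengthX_le uA.
(* Strong induction on the cross number stands in for choosing a minimal atom: any lighter atom over
   the support of [V] already weighs at least [n]. *)
move=> U; have [b] := ubnP (cross U); elim: b U => // b IHb V ltVb aV oV.
rewrite leqNgt; apply/negP => ltVn; apply: (small V) => // g.
apply: minimal_cross_mult => // U aU oU; rewrite leqNgt; apply/negP => ltUV.
suff : n <= cross U by rewrite leqNgt (ltn_trans ltUV ltVn).
by apply: IHb => //; [apply: leq_trans ltUV _ | move=> h /oU/oV].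
Qed.

(** The last hypothesis says that each [residue V j * V] divides [A ^ N], which forces
    [cross V = n]. *)
Lemma unique_lengthX_box A N : sigma A = 0%R -> n <= N -> unique_length (A ^+ N) ->
  (forall V, atom V -> over_supp A V -> cross V < n ->
    (forall g, (mult V g).*2 < o g) ->
    forall j g, 0 < mult V g ->
      (j * mult V g) %% o g + mult V g <= N * mult A g) ->
  forall m, unique_length (A ^+ m).
Proof.
move=> A0 nN uA box; apply: (unique_lengthX A0 nN uA) => V aV oV ltVn ltV.
suff : cross V = n by move=> E; rewrite E ltnn in ltVn.
apply: (cross_of_residue A0 uA aV) => j g.
case: (posnP (mult V g)) => [->|Vg]; last exact: (box V).
by rewrite muln0 mod0n.
Qed.

(** A residue is at most [ord g - 1] and a multiplicity at most [(ord g - 1) / 2], so together they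
    stay within [3 (n - 1) / 2]. *)
Lemma unique_lengthX_three_halves A : sigma A = 0%R -> 2 < n ->
  unique_length (A ^+ (3 * n.-1)./2) -> forall m, unique_length (A ^+ m).
Proof.
move=> A0 n_gt2 uA; apply: (unique_lengthX_box A0 _ uA); first by lia.
move=> V aV oV _ ltV j g Vg; have := oV g Vg; have := ltV g; have := o_le g.
have := ltn_pmod (j * mult V g) (o_gt0 g); set r := _ %% _.
move=> *; apply: leq_trans (_ : (3 * n.-1)./2 * 1 <= _); first by lia.
by rewrite leq_mul2l; apply/orP; right; lia.
Qed.
End CrossNumber.

(** * Exponent at most six *)

Section SmallExponent.
Variables (G : zmodType) (n : nat).
Hypothesis ann : annihilator G n.
Notation F := (free_monoid G).
Notation o := zorder.
Implicit Types (A X Y Z U V : F) (g h : G).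

Lemma weight1_le_cross V : weight (fun=> 1) V <= cross n V.
Proof.
rewrite /cross !(weight_supp _ (supp_uniq V))//.
by apply: leq_sum => g _; rewrite leq_mul2l cross_coef_gt0// orbT.
Qed.

(* The case in which the residues of [g ^ 2 R] leave the box [A ^ 5]: there
   [g] occurs only once in [A], and multiplying by [A] itself lets the
   multiplicity of [g] hit exactly [5]. *)
Lemma exponent5_obstruction A V g : n = 5 -> sigma A = 0%R ->
  unique_length (A ^+ 5) -> atom V -> over_supp A V -> cross n V < 5 ->
  (forall h, (mult V h).*2 < o h) -> mult V g = 2 -> mult A g = 1 -> False.
Proof.
move=> n5 A0 uA aV oV ltVn ltV Vg Ag; have [V0 nV1 irrV] := (atomP V).1 aV.
(* The order divides 5 and exceeds twice a positive multiplicity. *)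
have o5 h : 0 < mult V h -> o h = 5.
  move=> Vh; have := ltV h; have := annihilator_dvd h ann; rewrite n5.
  by rewrite (dvdn_divisors _ (isT : 0 < 5)) !inE => /orP[/eqP->|/eqP->] //; lia.
have V2 h : mult V h <= 2.
  case: (posnP (mult V h)) => [->//|Vh]; have := ltV h; rewrite o5//; lia.
have sV := leq_ltn_trans (weight1_le_cross V) ltVn.
have [R VE] : exists R, V = (pw g 2 * R)%g.
  by apply: seq_dvdP => h; rewrite mult_pw; case: eqP => // ->; rewrite Vg.
have Rg : mult R g = 0 by move: Vg; rewrite VE multM mult_pw eqxx; lia.
have RV h : h != g -> mult R h = mult V h.
  by move=> /negPf hg; rewrite VE multM mult_pw hg.
(* A second element [h] of multiplicity 2 would exhaust the length bound 4, so [V = (g h) ^ 2]. As 5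
   is odd, [g h] would be zero-sum, against [V] being an atom. *)
have R1 h : mult R h <= 1.
  have [->|hg] := eqVneq h g; first by rewrite Rg.
  rewrite RV// leqNgt; apply/negP => Vh2; have Vh : mult V h = 2 by have := V2 h; lia.
  pose Q := (pw g 1 * pw h 1)%g.
  have VQ : V = (Q * Q)%g.
    apply: multP => k; rewrite !multM !mult_pw.
    have [->|kg] := eqVneq k g; first by rewrite eq_sym (negPf hg).
    have [->|kh] := eqVneq k h; first by [].
    have [Y VY] : exists Y, V = (Q * Q * Y)%g.
      apply: seq_dvdP => x; rewrite !multM !mult_pw.
      have [->|xg] := eqVneq x g; first by rewrite eq_sym (negPf hg) Vg.
      by have [->|//] := eqVneq x h; rewrite Vh.
    have := sV; rewrite VY !weightM !weight_pw => sY.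
    have Y1 : Y = 1%g by apply: (@weight_eq0 _ (fun=> 1)) => //; lia.
    by rewrite Y1 mulg1 !multM !mult_pw (negPf kg) (negPf kh).
  have Q0 : sigma Q = 0%R.
    have QQ : (sigma Q *+ 2)%R = 0%R by rewrite mulr2n -sigmaM -VQ.
    have := ann.2 (sigma Q); rewrite n5 (mulrnDr _ 4 1) (mulrnA _ 2 2) QQ.
    by rewrite mul0rn add0r mulr1n.
  have Q1 : Q <> 1%g by move=> Q1; apply: nV1; rewrite VQ Q1 mulg1.
  by case: (irrV Q Q Q0 Q0 VQ).
have [B AE] : exists B, A = (pw g 1 * B)%g.
  by apply: seq_dvdP => h; rewrite mult_pw; case: eqP => // ->; rewrite Ag.
have Bg : mult B g = 0 by move: Ag; rewrite AE multM mult_pw eqxx; lia.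
have AB h : h != g -> mult A h = mult B h.
  by move=> /negPf hg; rewrite AE multM mult_pw hg.
have RA h : mult R h <= mult A h.
  have [->|hg] := eqVneq h g; first by rewrite Rg.
  have := R1 h; have := oV h; rewrite -RV//; lia.
have og : o g = 5 by rewrite o5// Vg.
have g5 : sigma (pw g 5) = 0%R by rewrite -og sigma_pw mulrn_zorder.
have A5_0 : sigma (A ^+ 5)%g = 0%R by rewrite sigmaX A0 mul0rn.
have facg5 : factors (pw g 5) 1.
  by rewrite -og; apply/factors_atom/atom_pw_zorder; rewrite og.
have [X XE] : exists X, X = (R ^+ 2 * B)%g by eexists.
have [Y YE] : exists Y, Y = (pw g 1 * R ^+ 3)%g by eexists.
(* All sides of the three identities divide [A ^ 5]. Comparing lengths gives [2 + a = 1 + x],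
   [x + 1 = y + a] and [2 + y = 1 + |R|], hence [|R| = 3] and [|V| = 5], although [|V| < 5]. *)
have E1 : (V * V * A = pw g 5 * X)%g.
  apply: multP => h; rewrite XE VE AE !(multX, multM) !mult_pw.
  by case: eqP => _; ring.
have E2 : (X * V = Y * A)%g.
  apply: multP => h; rewrite ?XE ?YE VE AE !(multX, multM) !mult_pw.
  by case: eqP => _; ring.
have E3 : (V * V * Y = pw g 5 * R ^+ 5)%g.
  apply: multP => h; rewrite YE VE !(multX, multM) !mult_pw.
  by case: eqP => _; ring.
have X0 : sigma X = 0%R.
  by move/(congr1 (@sigma G)): E1; rewrite !sigmaM V0 A0 g5 !add0r.
have Y0 : sigma Y = 0%R.
  by move/(congr1 (@sigma G)): E2; rewrite !sigmaM V0 A0 X0 !addr0.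
have [a Aa] := factors_exists A0; have [x Xx] := factors_exists X0.
have [y Yy] := factors_exists Y0.
have V_1 := factors_atom aV.
have facR5 : factors (R ^+ 5) (weight (fun=> 1) R).
  rewrite (weight_supp _ (supp_uniq R))//.
  suff -> : (R ^+ 5 = \prod_(h <- supp R) pw h (mult R h * o h))%g.
    rewrite (eq_bigr (mult R)); last by move=> h _; rewrite muln1.
    exact: (factors_prod_pw_zorder ann).
  apply: multP => h; rewrite multX mult_prod_supp => [|->//].
  have [->|hg] := eqVneq h g; first by rewrite Rg.
  by case: (posnP (mult R h)) => [->|Rh]; rewrite ?muln0// o5 1?mulnC// -RV.
have uW W k l : seq_dvd W (A ^+ 5) -> factors W k -> factors W l -> k = l.
  by move=> WA Wk; apply: (unique_length_dvd (factors_sigma Wk) A5_0 WA uA) Wk.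
have e1 : 2 + a = 1 + x.
  apply: (uW (pw g 5 * X)%g); last exact: factorsM.
    move=> h; rewrite XE !(multX, multM) mult_pw; have := RA h.
    by case: eqP => [->|/eqP hg]; rewrite ?Rg ?Bg ?Ag -?AB//; lia.
  by rewrite -E1; apply: factorsM Aa; exact: (factorsM V_1 V_1).
have e2 : x + 1 = y + a.
  apply: (uW (X * V)%g); [|exact: factorsM|by rewrite E2; apply: factorsM].
  move=> h; rewrite E2 YE !(multX, multM) !mult_pw; have := RA h; have := R1 h.
  by case: eqP => [->|/eqP hg]; rewrite ?Rg ?Ag//; lia.
have e3 : 2 + y = 1 + weight (fun=> 1) R.
  apply: (uW (pw g 5 * R ^+ 5)%g); last exact: factorsM.
    move=> h; rewrite !(multX, multM) !mult_pw; have := RA h.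
    by case: eqP => [->|/eqP hg]; rewrite ?Rg ?Ag//; lia.
  by rewrite -E3; apply: factorsM Yy; exact: (factorsM V_1 V_1).
by move: sV; rewrite VE weightM weight_pw; lia.
Qed.

(** A multiplicity below half the order is 1 or 2. Multiplicity 1 always fits the box. Multiplicity
    2 needs order 5 or 6: for 6 the residues of [2 j] are even, so at most 4, and [4 + 2] fits; for
    5 the box can fail only when [g] occurs once in [A]. *)
Lemma unique_lengthX_exponent_le6 A : n <= 6 -> sigma A = 0%R ->
  unique_length (A ^+ n) -> forall m, unique_length (A ^+ m).
Proof.
move=> n_le6 A0 uA; apply: (unique_lengthX_box ann A0 (leqnn n) uA).
move=> V aV oV ltVn ltV j g Vg; have Ag := oV g Vg; have := ltV g.
have o_le : o g <= n by apply: dvdn_leq (annihilator_dvd g ann); case: ann.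
have := ltn_pmod (j * mult V g) (annihilator_zorder_gt0 g ann).
have [Vg1|Vg2] : mult V g = 1 \/ mult V g = 2 by have := ltV g; lia.
  by rewrite Vg1 => *; apply: leq_trans (leq_pmulr _ Ag); lia.
rewrite Vg2 => rlt o_gt4.
have [o6|o5] : o g = 6 \/ o g = 5 by lia.
  have n6 : n = 6 by lia.
  by apply: leq_trans (leq_pmulr _ Ag); rewrite o6 n6; lia.
have n5 : n = 5.
  have := annihilator_dvd g ann; rewrite o5 => /dvdnP[[|[|q]]] //; lia.
have [Ag1|Ag2] : mult A g = 1 \/ 1 < mult A g by lia.
  rewrite {1}n5 in uA; rewrite {2}n5 in ltVn.
  by case: (exponent5_obstruction n5 A0 uA aV oV ltVn ltV Vg2 Ag1).
by rewrite n5; apply: leq_trans (_ : 5 * 2 <= _); [lia | rewrite leq_mul2l].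
Qed.

End SmallExponent.

(** * Cyclic groups *)

Section Cyclic.
Variables (G : zmodType) (n : nat).
Hypothesis ann : annihilator G n.
Notation F := (free_monoid G).
Notation o := zorder.
Implicit Types (A X Y Z U V : F) (g h : G).

(* With [U = g ^ (n - a) h] and [Z = g ^ a h ^ (ord h - 1)], the product
   [U Z = g ^ n h ^ (ord h)] has length 2, so [Z] is an atom; but [Z] is
   divisible by a zero-sum sequence in which [g] occurs [gcd(a, n)] times. *)
Lemma multiple_dvd_exponent A g h a : sigma A = 0%R -> unique_length (A ^+ n) ->
  0 < mult A g -> 0 < mult A h -> o g = n -> h = (g *+ a)%R -> 0 < a <= n ->
  a %| n.
Proof.
move=> A0 uA Ag Ah og hE /andP[a_gt0 a_le]; have [n_gt0 _] := ann.
have o_gt0 (x : G) : 0 < o x := annihilator_zorder_gt0 x ann.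
(* For [h = g], [a] is 1 modulo [n], so [a = 1]. *)
have [hg|hg] := eqVneq h g.
  have : (g *+ a.-1 == 0)%R.
    have : g = (g *+ a)%R by rewrite -hE hg.
    by rewrite -{1}(prednK a_gt0) mulrS => /eqP; rewrite addrC -subr_eq subrr eq_sym.
  rewrite zorder_dvd og => /dvdnP[[|q] qE]; first by rewrite (_ : a = 1)//; lia.
  by rewrite mulSn in qE; lia.
pose m := o h; have m_gt0 : 0 < m by apply: o_gt0.
have mh : (h *+ m = 0)%R by apply: mulrn_zorder.
have gn : (g *+ n = 0)%R by apply: ann.2.
have [u w uw _] := egcdnP n a_gt0; rewrite gcdnC in uw; pose d := gcdn n a.
have d_gt0 : 0 < d by rewrite gcdn_gt0 n_gt0.
have d_le : d <= a by apply: dvdn_leq => //; apply: dvdn_gcdr.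
(* Bezout's identity [u a = w n + d] gives [u h = d g]. As [c] is [-u] reduced modulo [ord h],
   [g ^ d h ^ c] is a zero-sum divisor of [Z]. *)
pose c := (m - u %% m) %% m; have c_lt : c < m by rewrite ltn_mod.
have um : u %% m < m by rewrite ltn_mod.
have cu : m %| c + u.
  by rewrite /dvdn /c modnDml -modnDmr subnK ?modnn// ltnW.
pose U := (pw g (n - a) * pw h 1)%g; pose Z := (pw g a * pw h m.-1)%g.
pose Y := (pw g d * pw h c)%g; pose Y' := (pw g (a - d) * pw h (m.-1 - c))%g.
have U0 : sigma U = 0%R.
  by rewrite sigmaM !sigma_pw mulr1n hE -mulrnDr subnK// gn.
have Z0 : sigma Z = 0%R.
  by rewrite sigmaM !sigma_pw -hE -mulrS prednK.
have Y0 : sigma Y = 0%R.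
  rewrite sigmaM !sigma_pw; apply: (@addIr _ (h *+ u)%R).
  rewrite add0r -addrA -mulrnDr.
  have -> : (h *+ (c + u) = 0)%R by apply/eqP; rewrite zorder_dvd.
  by rewrite addr0 hE -mulrnA [a * u]mulnC uw mulrnDr [w * n]mulnC mulrnA gn mul0rn add0r.
have ZE : Z = (Y * Y')%g.
  apply: multP => k; rewrite !multM !mult_pw.
  by case: eqP => _; case: eqP => _; lia.
have Y'0 : sigma Y' = 0%R by move: Z0; rewrite ZE sigmaM Y0 add0r.
have UZE : (U * Z = pw g n * pw h m)%g.
  apply: multP => k; rewrite !multM !mult_pw.
  by case: eqP => _; case: eqP => _; lia.
have f2 : factors (U * Z) (1 + 1).
  rewrite UZE; apply: factorsM; apply: factors_atom; last exact: atom_pw_zorder.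
  by rewrite -{1}og; apply: atom_pw_zorder.
have [k Uk] := factors_exists U0; have [l Zl] := factors_exists Z0.
have kl2 : k + l = 2.
  apply: (unique_length_dvd _ _ _ uA) (factorsM Uk Zl) f2.
  - by rewrite sigmaM U0 Z0 addr0.
  - by rewrite sigmaX A0 mul0rn.
  move=> x; rewrite UZE multX multM !mult_pw; case: eqP => [->|_].
    by rewrite eq_sym (negPf hg) addn0 leq_pmulr.
  case: eqP => [->|//]; apply: leq_trans (leq_pmulr _ Ah).
  by apply: dvdn_leq => //; apply: annihilator_dvd ann.
have gW i j : mult (pw g i * pw h j) g = i.
  by rewrite multM !mult_pw eqxx eq_sym (negPf hg) addn0.
have U1 : U <> 1%g.
  move/(congr1 (mult^~ h)).
  by rewrite multM !mult_pw eqxx (negPf hg) mult1.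
have Z1 : Z <> 1%g by move/(congr1 (mult^~ g)); rewrite gW mult1; lia.
have Y1 : Y <> 1%g by move/(congr1 (mult^~ g)); rewrite gW mult1; lia.
have k_gt0 := factors_gt0 U1 Uk; have l_gt0 := factors_gt0 Z1 Zl.
have l1 : l = 1 by lia.
rewrite l1 in Zl; have /atomP[_ _ irrZ] := factors1_atom Zl.
case: (irrZ Y Y' Y0 Y'0 ZE) => // Y'1.
have ad : a = d.
  by have := congr1 (mult^~ g) ZE; rewrite Y'1 mulg1 !gW.
by rewrite ad; apply: dvdn_gcdl.
Qed.

(** Write [h = f(h) g]. Since [f(h)] divides [n], the coefficient [n / ord h] is [f(h)] itself, so
    [sigma V = (cross n V) g]. This sum vanishes, hence [n] divides the positive number
    [cross n V]. *)
Lemma cyclic_cross_ge A V g : sigma A = 0%R -> unique_length (A ^+ n) ->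
  atom V -> over_supp A V -> 0 < mult A g -> o g = n ->
  (forall h, exists k : nat, h = (g *+ k)%R) -> n <= cross n V.
Proof.
move=> A0 uA aV oV Ag og gen; have [n_gt0 gn] := ann.
have /choice[f fE] : forall h, exists k, h = (g *+ k)%R /\ 0 < k <= n.
  move=> h; have [k kE] := gen h; have kmodE : h = (g *+ (k %% n))%R.
    by rewrite kE -og mulrn_mod_zorder.
  case: (posnP (k %% n)) => [k0|k_gt0].
    (* Zero is represented by [n], which keeps every representative positive. *)
    by exists n; rewrite n_gt0 leqnn; split; rewrite // gn kmodE k0 mulr0n.
  by exists (k %% n); rewrite k_gt0 ltnW// ltn_mod.
have foE h : 0 < mult V h -> n %/ o h = f h.
  move=> Vh; have [hE fh] := fE h; have f_gt0 : 0 < f h by case/andP: fh.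
  have fn := multiple_dvd_exponent A0 uA Ag (oV h Vh) og hE fh.
  have -> : o h = n %/ f h.
    by rewrite {1}hE; apply: zorder_mulrn => //; rewrite mulnC divnK.
  by rewrite -{1}(divnK fn) mulKn// divn_gt0// dvdn_leq.
have [V0 _ _] := (atomP V).1 aV.
have crossE : cross n V = \sum_(h <- supp V) mult V h * f h.
  rewrite /cross (weight_supp _ (supp_uniq V))// big_seq [RHS]big_seq.
  by apply: eq_bigr => h; rewrite mem_supp => /foE->.
apply: dvdn_leq.
  by apply: atom_weight_gt0 aV => h; apply: cross_coef_gt0.
rewrite -{1}og -zorder_dvd crossE; apply/eqP; transitivity (sigma V) => //.
rewrite -sumrMnr (sigma_supp (supp_uniq V))//; apply: eq_bigr => h _.
by rewrite mulnC mulrnA -(fE h).1.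
Qed.

Lemma unique_lengthX_cyclic A : is_cyclic G -> sigma A = 0%R ->
  unique_length (A ^+ n) -> forall m, unique_length (A ^+ m).
Proof.
move=> [x genx] A0 uA; have [n_gt0 gn] := ann.
have genN y : exists k : nat, y = (x *+ k)%R.
  have [[k|k] ->] := genx y; first by exists k.
  exists (k.+1 * n.-1); apply/eqP; rewrite NegzE mulrNz eq_sym -subr_eq0 opprK.
  by rewrite -mulrnDr -{2}[k.+1]muln1 -mulnDr addn1 prednK// mulnC mulrnA gn mul0rn.
apply: (unique_lengthX_box ann A0 (leqnn n) uA).
move=> V aV oV ltVn ltV j g Vg; have Ag := oV g Vg.
have og := annihilator_dvd g ann.
(* A proper divisor of [n] is at most [n / 2], so the box has room. If instead [ord g = n], then [g]
   generates [G] and [V] cannot be light. *)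
have [og_eq|og_ne] := eqVneq (o g) n; last first.
  have og2 : (o g).*2 <= n.
    case/dvdnP: og og_ne => -[|[|q]] E; rewrite E; lia.
  apply: leq_trans (leq_pmulr _ Ag); have := ltV g.
  have := ltn_pmod (j * mult V g) (annihilator_zorder_gt0 g ann); lia.
suff /(cyclic_cross_ge A0 uA aV oV Ag og_eq) : forall h, exists k, h = (g *+ k)%R.
  by rewrite leqNgt ltVn.
have [c gE] := genN g; have c_gt0 : 0 < c \/ n = 1.
  case: c gE => [|c] gE; last by left.
  right; rewrite -og_eq; apply: zorder_unique => k.
  by rewrite gE mulr0n mul0rn eqxx dvd1n.
(* Here [g = c x] is killed by [n / gcd(n, c)], so order [n] forces the gcd to be 1, and Bezout's
   identity makes [x] a multiple of [g]. *)
have co : coprime n c.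
  case: c_gt0 => [c_gt0|->]; last exact: coprime1n.
  have : (g *+ (n %/ gcdn n c) == 0)%R.
    rewrite gE -mulrnA -muln_divCA_gcd mulrnA gn mul0rn//.
  rewrite zorder_dvd og_eq => /dvdn_leq; rewrite divn_gt0 ?gcdn_gt0 ?n_gt0//.
  rewrite dvdn_leq ?dvdn_gcdl// => /(_ isT) le_n.
  rewrite /coprime eqn_leq gcdn_gt0 n_gt0 andbT leqNgt; apply/negP => d_gt1.
  by have := ltn_Pdiv d_gt1 n_gt0; rewrite ltnNge le_n.
move=> h; have [k ->] := genN h.
have [c' c'E] : exists c', x = (g *+ c')%R.
  case: c_gt0 => [c_gt0|n1]; last first.
    have triv y : y = 0%R :> G by rewrite -[y]mulr1n -n1 gn.
    by exists 0; rewrite mulr0n; apply: triv.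
  have [u w uw _] := egcdnP n c_gt0; exists u.
  rewrite gE -mulrnA mulnC uw gcdnC (eqP co) mulrnDr mulnC mulrnA gn mul0rn.
  by rewrite add0r mulr1n.
by exists (c' * k); rewrite c'E mulrnA.
Qed.

End Cyclic.

(** * Lower bounds *)

Section LowerBounds.
Variable G : zmodType.
Notation F := (free_monoid G).
Notation o := zorder.
Implicit Types (A X Y Z U V : F) (g h e : G).

(** The property defining [hf], read in the monoid of zero-sum sequences. *)
Definition determines_lengths N := forall A, sigma A = 0%R ->
  unique_length (A ^+ N) -> forall m, unique_length (A ^+ m).

Lemma atom_dvd_eq X U : sigma X = 0%R -> X <> 1%g -> atom U -> seq_dvd X U ->
  U = X.
Proof.
move=> X0 nX1 /atomP[U0 _ irrU] /seq_dvdP[Y UE].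
have Y0 : sigma Y = 0%R by move: U0; rewrite UE sigmaM X0 add0r.
by case: (irrU X Y X0 Y0 UE) => // Y1; rewrite UE Y1 mulg1.
Qed.

Lemma mulrn_inj_below e M x y : (forall j, 0 < j <= M -> (e *+ j)%R <> 0%R) ->
  x <= M -> y <= M -> (e *+ x = e *+ y)%R -> x = y.
Proof.
move=> eM; wlog le_yx : x y / y <= x => [hw|].
  move=> xM yM exy; have [yx|/ltnW xy] := leqP y x; first exact: hw.
  by apply/esym; apply: hw.
move=> xM _ exy; apply/eqP; rewrite eqn_leq le_yx andbT -subn_eq0 -leqn0 leqNgt.
apply/negP => d_gt0; apply: (eM (x - y)); first by rewrite d_gt0; lia.
by rewrite mulrnBr// exy subrr.
Qed.

Lemma pw_neq1 g n : 0 < n -> pw g n <> 1%g.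
Proof. by move=> n_gt0 /(congr1 (mult^~ g)); rewrite mult_pw eqxx mult1; lia. Qed.

Lemma seq_mul_neq1 X Y : X <> 1%g -> (X * Y)%g <> 1%g.
Proof. by move=> nX1 /seq_mul_eq1. Qed.

(** Let [A = g (-g)] and suppose [N < ord g]. A zero-sum divisor of [A ^ N] contains [g] and [-g]
    equally often, so [A] is the only atom there. But [A ^ (ord g)] also splits into the two blocks
    of [g] and [-g], and [2 < ord g]. *)
Lemma determines_lengths_order g N : 0 < N -> determines_lengths N ->
  2 < o g -> o g <= N.
Proof.
move=> N_gt0 detN og; rewrite leqNgt; apply/negP => ltN.
have gN j : 0 < j <= N -> (g *+ j)%R <> 0%R.
  case/andP=> j_gt0 jN /eqP; rewrite zorder_dvd => /dvdn_leq -/(_ j_gt0); lia.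
have gNg : (g == - g)%R = false.
  apply/negP; rewrite -subr_eq0 opprK -mulr2n zorder_dvd => /dvdn_leq; lia.
pose A := (pw g 1 * pw (- g)%R 1)%g.
have A0 : sigma A = 0%R by rewrite sigmaM !sigma_pw !mulr1n subrr.
have A1 : A <> 1%g by apply/seq_mul_neq1/pw_neq1.
have atomA U : atom U -> seq_dvd U (A ^+ N) -> weight (fun=> 1) U = 2.
  move=> aU UA; have [U0 U1 _] := (atomP U).1 aU.
  have mU h : mult U h <= N * ((h == g) + (h == - g)%R).
    have := UA h; rewrite multX multM !mult_pw.
    by case: (h == g); case: (h == - g)%R; rewrite ?addn0.
  have uD : uniq [:: g; (- g)%R] by rewrite /= inE gNg.
  have sD : {subset supp U <= [:: g; (- g)%R]}.
    move=> h; rewrite mem_supp !inE => Uh; have := mU h.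
    by case: (h == g); case: (h == - g)%R => //; lia.
  have xy : mult U g = mult U (- g)%R.
    have := sigma_supp uD sD; rewrite U0 !big_cons big_nil addr0 mulNrn => /esym.
    move/eqP; rewrite subr_eq0 => /eqP; apply: mulrn_inj_below gN _ _.
      by have := mU g; rewrite eqxx gNg; lia.
    by have := mU (- g)%R; rewrite eqxx eq_sym gNg; lia.
  suff -> : U = A by rewrite weightM !weight_pw.
  apply: atom_dvd_eq => // h; rewrite multM !mult_pw.
  have Ug : 0 < mult U g.
    case: (posnP (mult U g)) => // Ug0; case: U1.
    apply: (@weight_eq0 _ (fun=> 1)) => //.
    by rewrite (weight_supp _ uD sD) !big_cons big_nil -xy Ug0.
  case: eqP => [->|_]; first by rewrite gNg addn0.
  by case: eqP => [->|]; rewrite -?xy.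
have uA : unique_length (A ^+ N).
  by move=> k l /(factors_weight atomA) + /(factors_weight atomA) => ->; lia.
have [l Al] := factors_exists A0.
have l_gt0 := factors_gt0 A1 Al.
have AoE : (A ^+ o g = pw g (o g) * pw (- g)%R (o g))%g.
  apply: multP => h; rewrite multX !multM !mult_pw.
  by case: (h == g); case: (h == - g)%R; lia.
have oN : o (- g)%R = o g.
  by apply: zorder_unique => k; rewrite mulNrn oppr_eq0 zorder_dvd.
have og_gt0 : 0 < o g by lia.
have A2 : factors (A ^+ o g) (1 + 1).
  rewrite AoE; apply: factorsM; apply: factors_atom; first exact: atom_pw_zorder.
  by rewrite -{1}oN; apply: atom_pw_zorder; rewrite oN.
have := detN A A0 uA (o g) _ _ (factorsX (o g) Al) A2.
by have := leq_pmulr (o g) l_gt0; lia.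
Qed.

(** For [N = 1] take [A = g h (g + h)], of length 3 and without zero terms: it has only the length
    1, while [A ^ 2] has length 2 and, as a product of three squares, a length at least 3. *)
Lemma determines_lengths_exponent2 g h N : 0 < N -> determines_lengths N ->
  g <> 0%R -> h <> 0%R -> g <> h -> (g *+ 2 = 0)%R -> (h *+ 2 = 0)%R -> 2 <= N.
Proof.
move=> N_gt0 detN g0 h0 gh g2 h2; rewrite ltnNge; apply/negP => N_le1.
have N1 : N = 1 by lia.
pose A := (pw g 1 * pw h 1 * pw (g + h)%R 1)%g.
have gh2 : ((g + h) *+ 2 = 0)%R by rewrite mulrnDl g2 h2 addr0.
have A0 : sigma A = 0%R by rewrite !sigmaM !sigma_pw !mulr1n -mulr2n.
have gh0 : (g + h <> 0)%R.
  by move=> E; apply: gh; apply: (addIr h); rewrite E -mulr2n h2.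
have A1 : A <> 1%g by apply/seq_mul_neq1/seq_mul_neq1/pw_neq1.
have A_nz x : 0 < mult A x -> x <> 0%R.
  by move=> + x0; rewrite x0 !multM !mult_pw; do 3![case: eqP => [/esym//|_]].
have atomA U : atom U -> seq_dvd U A -> 2 <= weight (fun=> 1) U.
  move=> aU UA; have [U0 U1 _] := (atomP U).1 aU.
  rewrite ltnNge; apply/negP => U_le1.
  have [x Ux] : exists x, 0 < mult U x.
    apply: contra_notP U1 => nU; apply: multP => x; rewrite mult1.
    by apply/eqP; rewrite -leqn0 leqNgt; apply/negP => Ux; apply: nU; exists x.
  have [Y UE] : exists Y, U = (pw x 1 * Y)%g.
    by apply: seq_dvdP => y; rewrite mult_pw; case: eqP => // ->.
  have Y1 : Y = 1%g.
    apply: (@weight_eq0 _ (fun=> 1)) => //.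
    by move: U_le1; rewrite UE weightM weight_pw; lia.
  apply: (A_nz x); first exact: leq_trans (UA x).
  by move: U0; rewrite UE Y1 mulg1 sigma_pw.
have wA : weight (fun=> 1) A = 3 by rewrite !weightM !weight_pw.
have lenA k : factors A k -> k = 1.
  move=> Ak; have := factors_gt0 A1 Ak.
  by have := factors_weight_ge atomA Ak; rewrite wA; lia.
have uA : unique_length (A ^+ N).
  by rewrite N1 expg1 => k l /lenA-> /lenA.
have [l Al] := factors_exists A0.
have pw2 (x : G) : (x *+ 2 = 0)%R -> exists2 k, 0 < k & factors (pw x 2) k.
  rewrite -sigma_pw => /factors_exists[k xk]; exists k => //.
  by apply: (factors_gt0 _ xk); apply: pw_neq1.
have [a a_gt0 ga] := pw2 g g2; have [b b_gt0 hb] := pw2 h h2.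
have [c c_gt0 ghc] := pw2 _ gh2.
have A2 : (A ^+ 2 = pw g 2 * pw h 2 * pw (g + h)%R 2)%g.
  apply: multP => x; rewrite multX !multM !mult_pw.
  by case: (x == g); case: (x == h); case: (x == g + h)%R.
have := detN A A0 uA 2 _ _ (factorsX 2 Al); rewrite A2.
move/(_ _ (factorsM (factorsM ga hb) ghc)); rewrite (lenA _ Al); lia.
Qed.

(** An atom avoiding [h] would be a zero-sum power of [g] with positive exponent at most [n]. So
    each factor contains [h], which occurs only once. *)
Lemma factors_pw_le1 g h n p : g <> h ->
  (forall j, 0 < j <= n -> (g *+ j)%R <> 0%R) ->
  factors (pw g n * pw h 1)%g p -> p <= 1.
Proof.
move=> gh gn /(@factors_weight_ge _ (fun x => (x == h) : nat) 1) wp.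
have : p * 1 <= weight (fun x => (x == h) : nat) (pw g n * pw h 1)%g.
  apply: wp => U aU UX; rewrite leqNgt; apply/negP => Uh.
  have [U0 U1 _] := (atomP U).1 aU.
  have mU x : x != g -> mult U x = 0.
    move=> /negPf xg; have := UX x; rewrite multM !mult_pw xg add0n.
    case: eqP => [-> _|_]; last by lia.
    apply/eqP; rewrite -leqn0 leqNgt; apply/negP => hU.
    have [Y UE] : exists Y, U = (pw h 1 * Y)%g.
      by apply: seq_dvdP => y; rewrite mult_pw; case: eqP => // ->.
    by move: Uh; rewrite UE weightM weight_pw eqxx; lia.
  have UE : U = pw g (mult U g).
    by apply: multP => x; rewrite mult_pw; case: eqP => [->//|/eqP/mU].
  have Ug := UX g; rewrite multM !mult_pw eqxx in Ug.
  case: eqP Ug => [/gh//|_]; rewrite addn0 => Ug.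
  apply: (gn (mult U g)); last by rewrite -sigma_pw -UE.
  rewrite Ug andbT lt0n; apply: contra_notN U1 => /eqP Ug0.
  by rewrite UE Ug0; apply: multP => x; rewrite mult_pw mult1 if_same.
rewrite muln1 => /leq_trans; apply.
by rewrite weightM !weight_pw eqxx; case: eqP => // _; rewrite muln0.
Qed.

(* [A = e (-e) f (-f)] with [f = (N + 1) e]: up to the power [N] only the two
   atoms [e (-e)] and [f (-f)] occur, while [e ^ (N + 1) (-f)] divides
   [A ^ (N + 1)]. *)
Lemma determines_lengths_bounded N : 0 < N -> determines_lengths N ->
  forall e, exists2 j, 0 < j <= N.+1 ^ 2 & (e *+ j = 0)%R.
Proof.
move=> N_gt0 detN e; apply: contrapT => ne.
have {ne} eM j : 0 < j <= N.+1 ^ 2 -> (e *+ j)%R <> 0%R.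
  by move=> jM j0; apply: ne; exists j.
pose f := (e *+ N.+1)%R.
have e_inj x y : x <= N.+1 ^ 2 -> y <= N.+1 ^ 2 -> (e *+ x = e *+ y)%R -> x = y.
  exact: mulrn_inj_below.
have eNe : (e == - e)%R = false.
  apply/eqP => E; apply: (eM 2); first by rewrite expnS expn1; nia.
  by rewrite mulr2n {2}E subrr.
have fNf : (f == - f)%R = false.
  apply/eqP => E; apply: (eM (N.+1 * 2)); first by rewrite expnS expn1; nia.
  by rewrite mulrnA mulr2n -/f {2}E subrr.
have ef : (e == f)%R = false.
  apply/eqP; rewrite -{1}[e]mulr1n => /e_inj; rewrite expnS expn1; nia.
have eNf : (e == - f)%R = false.
  apply/eqP => E; apply: (eM N.+2); first by rewrite expnS expn1; nia.
  by rewrite mulrS -/f E addNr.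
have Nef : (- e == f)%R = false by rewrite -eNf -{2}[e]opprK eqr_opp.
have NeNf : (- e == - f)%R = false by rewrite eqr_opp.
pose P := (pw e 1 * pw (- e)%R 1)%g; pose Q := (pw f 1 * pw (- f)%R 1)%g.
have P0 : sigma P = 0%R by rewrite sigmaM !sigma_pw !mulr1n subrr.
have Q0 : sigma Q = 0%R by rewrite sigmaM !sigma_pw !mulr1n subrr.
have P1 : P <> 1%g by apply/seq_mul_neq1/pw_neq1.
have Q1 : Q <> 1%g by apply/seq_mul_neq1/pw_neq1.
pose A := (P * Q)%g.
have A0 : sigma A = 0%R by rewrite sigmaM P0 Q0 addr0.
have mA x : mult A x = (x == e) + (x == - e)%R + ((x == f) + (x == - f)%R).
  rewrite !multM !mult_pw.
  by case: (x == e); case: (x == - e)%R; case: (x == f); case: (x == - f)%R.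
have eq_simp := (eqxx, eNe, fNf, ef, eNf, Nef, NeNf).
have eq_simp' := (eq_sym f e, eq_sym (- e)%R e, eq_sym (- f)%R e,
  eq_sym f (- e)%R, eq_sym (- f)%R (- e)%R, eq_sym (- f)%R f).
have atomA U : atom U -> seq_dvd U (A ^+ N) -> weight (fun=> 1) U = 2.
  move=> aU UA; have [U0 U1 _] := (atomP U).1 aU.
  have mU := UA.
  have uD : uniq [:: e; (- e)%R; f; (- f)%R] by rewrite /= !inE !eq_simp.
  have sD : {subset supp U <= [:: e; (- e)%R; f; (- f)%R]}.
    move=> x; rewrite mem_supp !inE => Ux; have := mU x; rewrite multX mA.
    by case: (x == e); case: (x == - e)%R; case: (x == f); case: (x == - f)%R => //; lia.
  have := mU e; have := mU (- e)%R; have := mU f; have := mU (- f)%R.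
  rewrite !multX !mA !eq_simp' !eq_simp !muln1 => d_le c_le b_le a_le.
  have := sigma_supp uD sD; rewrite U0 !big_cons big_nil addr0 !mulNrn.
  rewrite /f -!mulrnA; move: a_le b_le c_le d_le.
  set a := mult U e; set b := mult U (- e)%R; set c := mult U f.
  set d := mult U (- f)%R => a_le b_le c_le d_le.
  move=> /esym/eqP; rewrite addrA addrACA -mulrnDr.
  rewrite -opprD -mulrnDr subr_eq0 => /eqP/e_inj.
  (* The multiplicities are digits in base [N + 1]. Multiples of [e] are distinct up to
     [(N + 1) ^ 2], so the two numbers agree, and then so do their digits. *)
  have leM x y : x <= N -> y <= N -> x + N.+1 * y <= N.+1 ^ 2.
    by move=> xN yN; rewrite expnS expn1; nia.
  move=> /(_ (leM _ _ a_le c_le) (leM _ _ b_le d_le)) abcd.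
  have ab : a = b.
    have := congr1 (modn^~ N.+1) abcd.
    by rewrite ![_ + N.+1 * _]addnC ![N.+1 * _]mulnC !modnMDl !modn_small.
  have cd : c = d by apply/eqP; rewrite -(eqn_pmul2l (ltn0Sn N)); lia.
  have wPQ W : W = P \/ W = Q -> weight (fun=> 1) W = 2.
    by case=> ->; rewrite weightM !weight_pw.
  apply: wPQ.
  case: (posnP a) => [a0|a_gt0]; last first.
    left; apply: atom_dvd_eq => // x; rewrite multM !mult_pw.
    have [->|xe] := eqVneq x e; first by rewrite eNe addn0.
    by have [->|//] := eqVneq x (- e)%R; rewrite -/b -ab.
  right; apply: atom_dvd_eq => //.
  have c_gt0 : 0 < c.
    case: (posnP c) => // c0; case: U1; apply: (@weight_eq0 _ (fun=> 1)) => //.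
    rewrite (weight_supp _ uD sD) !big_cons big_nil -/a -/b -/c -/d.
    by rewrite -ab -cd a0 c0.
  move=> x; rewrite multM !mult_pw.
  have [->|xe] := eqVneq x f; first by rewrite fNf addn0.
  by have [->|//] := eqVneq x (- f)%R; rewrite -/d -cd.
have uA : unique_length (A ^+ N).
  by move=> k l /(factors_weight atomA) + /(factors_weight atomA) => ->; lia.
pose S := (pw e N.+1 * pw (- f)%R 1)%g; pose S' := (pw (- e)%R N.+1 * pw f 1)%g.
have S0 : sigma S = 0%R by rewrite sigmaM !sigma_pw mulr1n subrr.
have S'0 : sigma S' = 0%R by rewrite sigmaM !sigma_pw mulr1n mulNrn addNr.
have [k Pk] := factors_exists P0; have [l Ql] := factors_exists Q0.
have [p Sp] := factors_exists S0; have [q S'q] := factors_exists S'0.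
have k_gt0 := factors_gt0 P1 Pk; have l_gt0 := factors_gt0 Q1 Ql.
have le_M : N.+1 <= N.+1 ^ 2 by rewrite expnS expn1; nia.
have p_le1 : p <= 1.
  apply: factors_pw_le1 Sp; first by apply/eqP; rewrite eNf.
  by move=> j /andP[j0 jN]; apply: eM; rewrite j0 (leq_trans jN).
have q_le1 : q <= 1.
  apply: factors_pw_le1 S'q; first by apply/eqP; rewrite Nef.
  move=> j /andP[j0 jN]; rewrite mulNrn => /eqP; rewrite oppr_eq0 => /eqP.
  by apply: eM; rewrite j0 (leq_trans jN).
have AE : (A ^+ N.+1 = S * S' * Q ^+ N)%g.
  apply: multP => x; rewrite multX mA !multM multX !multM !mult_pw.
  by case: (x == e); case: (x == - e)%R; case: (x == f); case: (x == - f)%R; lia.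
(* Equal lengths would give [(N + 1) (k + l) = p + q + N l <= 2 + N l], impossible for positive [k],
   [l] and [N]. *)
have := detN A A0 uA N.+1 _ _ (factorsX N.+1 (factorsM Pk Ql)).
rewrite AE => /(_ _ (factorsM (factorsM Sp S'q) (factorsX N Ql))).
have : N.+1 <= N.+1 * k by rewrite leq_pmulr.
by rewrite mulnDr mulSn; lia.
Qed.

End LowerBounds.

(** * Transfer to [H] *)

Lemma single_lengthP (M : monoidType) (S : set M) (a : M) :
  single_length S a <-> (exists k, lengths S a k) /\
    forall k l, lengths S a k -> lengths S a l -> k = l.
Proof.
split=> [/card_set_bijP[f [f_fun f_inj f_surj]]|[[k ak] uniq_a]].
  split; first by have [|k ak _] := f_surj 0; [|exists k].
  move=> k l ak al; apply: f_inj; [exact: mem_set | exact: mem_set |].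
  have fk : f k < 1 by apply: f_fun.
  have fl : f l < 1 by apply: f_fun.
  by case: (f k) (f l) fk fl => [|?] [|?].
rewrite /single_length (_ : lengths S a = [set k]%classic) ?card_set1//.
by rewrite predeqE => l; split=> [al|->//]; apply: uniq_a.
Qed.

Section DivisorClosure.
Variables (M : monoidType) (a : M).
Implicit Types b u : M.
Let S := divisor_closure a.

Lemma divides_prod k (u : 'I_k -> M) i : divides (u i) (\prod_(j < k) u j)%g.
Proof.
elim: k u i => [|k IHk] u i; first by case: i.
rewrite big_ord_recl; case: (unliftP ord0 i) => [j ->|->].
  have [x [y ->]] := IHk (fun j => u (lift ord0 j)) j.
  by exists (u ord0 * x)%g, y; rewrite !mulgA.
by exists 1%g, (\prod_(j < k) u (lift ord0 j))%g; rewrite mul1g.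
Qed.

(** A unit and its inverse divide [a ^ 0 = 1], hence lie in the closure. *)
Lemma units_divisor_closure b : units S b <-> units setT b.
Proof.
split=> [[_ [v [_ bv vb]]]|[_ [v [_ bv vb]]]]; split=> //; try by exists v.
  by exists 0, 1%g, v; rewrite mul1g.
by exists v; split=> //; exists 0, 1%g, b; rewrite mul1g.
Qed.

Lemma atoms_divisor_closure u : atoms S u <-> S u /\ atoms setT u.
Proof.
split=> [[Su nu irru]|[Su [_ nu irru]]].
  split=> //; split=> // [/units_divisor_closure//|x y _ _ uE].
  have Sx : S x.
    by apply: divisor_closure_divides Su; exists 1%g, y; rewrite mul1g.
  have Sy : S y.
    by apply: divisor_closure_divides Su; exists x, 1%g; rewrite mulg1.
  by case: (irru x y Sx Sy uE) => /units_divisor_closure; [left|right].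
split=> // [/units_divisor_closure//|x y _ _ uE].
by case: (irru x y I I uE) => /units_divisor_closure; [left|right].
Qed.

(** All factors of [b] divide [b] and so stay in the closure. *)
Lemma lengths_divisor_closure b : S b -> lengths S b = lengths setT b.
Proof.
move=> Sb; rewrite predeqE => k; split.
  case=> [[/units_divisor_closure ub k0]|[nub k_gt0 [u [au bE]]]]; first by left.
  right; split=> //; first by move/units_divisor_closure.
  by exists u; split=> // i; have [] := (atoms_divisor_closure _).1 (au i).
case=> [[ub k0]|[nub k_gt0 [u [au bE]]]].
  by left; split=> //; apply/units_divisor_closure.
right; split=> //; first by move/units_divisor_closure.
exists u; split=> // i; apply/atoms_divisor_closure; split=> //.
by apply: divisor_closure_divides Sb; rewrite bE; apply: divides_prod.
Qed.

End DivisorClosure.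

Section Transfer.
Variables (H : monoidType) (G : zmodType) (theta : H -> free_monoid G).
Hypothesis wt : weak_transfer [set: G] theta.
Implicit Types a b u : H.

Let theta1 : theta 1%g = 1%g. Proof. by case: wt => -[]. Qed.
Let thetaM a b : theta (a * b)%g = (theta a * theta b)%g.
Proof. by case: wt => -[]. Qed.

Lemma thetaX a n : theta (a ^+ n)%g = (theta a ^+ n)%g.
Proof. by elim: n => [|n IHn]; rewrite ?expg0 ?theta1// !expgS thetaM IHn. Qed.

Lemma theta_prod k (u : 'I_k -> H) :
  theta (\prod_(i < k) u i)%g = (\prod_(i < k) theta (u i))%g.
Proof. exact: big_morph. Qed.

Lemma theta_zero_sum a : sigma (theta a) = 0%R.
Proof.
case: wt => _ rng _ _; apply/zero_sumT.
by rewrite -rng; exists a.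
Qed.

Lemma theta_surj A : sigma A = 0%R -> exists a, theta a = A.
Proof.
case: wt => _ rng _ _ /zero_sumT; rewrite -rng => -[a _ aA]; by exists a.
Qed.

Lemma theta_eq1 a : theta a = 1%g <-> units setT a.
Proof. by case: wt => _ _ <- _. Qed.

Lemma theta_lift a k : 0 < k -> factors (theta a) k ->
  exists u : 'I_k -> H, (forall i, atoms setT (u i)) /\ a = (\prod_(i < k) u i)%g.
Proof.
case: wt => _ _ _ lift k_gt0 [s [as_ sk sE]].
have [|||u [tau [au aE _]]] := lift a k (fun i => nth 1%g s i).
- by [].
- by move=> i; apply: as_; rewrite mem_nth// sk.
- by rewrite sE (big_nth 1%g) sk big_mkord.
by exists u.
Qed.

(** A factorization of the image into no atoms makes [u] a unit, and one into at least two atoms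
    lifts to a proper factorization of [u]. *)
Lemma theta_atom u : atoms setT u -> atom (theta u).
Proof.
move=> [_ nu irru]; have [[|[|k]] uk] := factors_exists (theta_zero_sum u).
- by case: nu; apply/theta_eq1; case: uk => s [_ /size0nil-> ->]; rewrite big_nil.
- exact: factors1_atom.
have [//|v [av uE]] := theta_lift _ uk.
rewrite big_ord_recl in uE; case: (irru _ _ I I uE) => [u1|/theta_eq1].
  by have [_ []] := av ord0.
rewrite big_ord_recl thetaM => /seq_mul_eq1/theta_eq1 u1.
by have [_ []] := av (lift ord0 ord0).
Qed.

Lemma factors_tuple k (v : 'I_k -> free_monoid G) : (forall i, atom (v i)) ->
  factors (\prod_(i < k) v i)%g k.
Proof.
move=> av; have := factors_prod (index_enum 'I_k) (fun i => factors_atom (av i)).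
by rewrite sum1_card card_ord.
Qed.

Lemma lengths_theta a k : lengths setT a k <-> factors (theta a) k.
Proof.
split=> [[[/theta_eq1-> ->]|[_ _ [u [au ->]]]]|ak].
- exact: factors1.
- by rewrite theta_prod; apply: factors_tuple => i; apply: theta_atom.
case: (posnP k) => [k0|k_gt0].
  left; split=> //; apply/theta_eq1; move: ak; rewrite k0 => -[s [_ + ->]].
  by move/size0nil->; rewrite big_nil.
right; split=> //; last exact: theta_lift.
by move=> /theta_eq1 a1; move: ak; rewrite a1 => /factors_eq1; lia.
Qed.

Lemma single_length_theta a : single_length setT a <-> unique_length (theta a).
Proof.
rewrite single_lengthP; split=> [[_ ua] k l /lengths_theta ak /lengths_theta al|ua].
  exact: ua.
split; last by move=> k l /lengths_theta ak /lengths_theta al; apply: ua.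
by have [k /lengths_theta ak] := factors_exists (theta_zero_sum a); exists k.
Qed.

(** Forwards, lift [A] to [a], whose powers lie in its divisor closure. Backwards, if [b] divides
    [a ^ n], then [theta b] divides [theta a ^ n] and inherits its unique length. *)
Lemma hf_property_iff N :
  (forall a, single_length setT (a ^+ N)%g -> half_factorial (divisor_closure a)) <->
  determines_lengths G N.
Proof.
split=> [hfN A A0 uA m|detN a].
  have [a aA] := theta_surj A0.
  have am : divisor_closure a (a ^+ m)%g by exists m, 1%g, 1%g; rewrite mul1g mulg1.
  have : single_length setT (a ^+ N)%g by apply/single_length_theta; rewrite thetaX aA.
  move=> /hfN/(_ _ am); rewrite /single_length lengths_divisor_closure//.
  by rewrite -aA -thetaX => /single_length_theta.
move=> /single_length_theta; rewrite thetaX => ua b ab.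
rewrite /single_length lengths_divisor_closure//; apply/single_length_theta.
case: ab => n [x [y anE]].
apply: unique_length_dvd (detN _ (theta_zero_sum a) ua n).
- exact: theta_zero_sum.
- by rewrite -thetaX theta_zero_sum.
by rewrite -thetaX anE !thetaM => g; rewrite !multM; lia.
Qed.

Lemma hf_eq : hf H = natinf [set N | 0 < N /\ determines_lengths G N]%classic.
Proof.
congr natinf; rewrite predeqE => N.
by split=> -[N_gt0 /hf_property_iff].
Qed.

End Transfer.

(** * The half-factoriality index *)

Local Open Scope classical_set_scope.
Local Open Scope card_scope.

Lemma natinf_attained (A : set nat) n : A n ->
  exists m, [/\ A m, forall k, A k -> m <= k & natinf A = (m%:R%R)%:E].
Proof.
move=> An; have exA : exists k, `[< A k >] by exists n; apply/asboolP.
have [m /asboolP Am minA] := ex_minnP exA.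
have min_m k : A k -> m <= k by move=> Ak; apply/minA/asboolP.
by exists m; split=> //; apply: natinf_min.
Qed.

Lemma natinf_empty (A : set nat) : (forall n, ~ A n) -> natinf A = +oo%E.
Proof.
move=> nA; rewrite (_ : A = set0) ?natinf0//.
by rewrite predeqE => n; split=> [/nA|].
Qed.

Lemma exponent_eq (G : zmodType) : exponent G = natinf (annihilator G).
Proof.
congr natinf; rewrite predeqE => n.
split=> [[n_gt0 ordn]|ann]; split=> //.
- move=> g; have [k [_ gk _] /dvdnP[q ->]] := ordn g.
  by rewrite mulnC mulrnA gk mul0rn.
- by case: ann.
move=> g; exists (zorder g); last exact: annihilator_dvd.
split; [exact: annihilator_zorder_gt0 ann|exact: mulrn_zorder|].
by move=> j j_gt0 /eqP; rewrite zorder_dvd => /dvdn_leq; apply.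
Qed.

Lemma bounded_orders_annihilator (G : zmodType) M :
  (forall e : G, exists2 j, 0 < j <= M & (e *+ j = 0)%R) -> annihilator G M`!.
Proof.
move=> bG; split=> [|e]; first exact: fact_gt0.
have [j jM ej] := bG e; have /dvdnP[q ->] := dvdn_fact jM.
by rewrite mulnC mulrnA ej mul0rn.
Qed.

Lemma card_eq2 (G : zmodType) (g : G) : g <> 0%R ->
  (forall h : G, h = 0%R \/ h = g) -> ([set: G] #= `I_2).
Proof.
move=> g0 G2; apply/card_set_bijP; exists (fun h => (h != 0%R) : nat).
split=> [h _|x y _ _|].
- by rewrite /= ltnS leq_b1.
- by case: (G2 x) (G2 y) => -> [] -> //; rewrite eqxx; case: eqP.
case=> [|[|//]] _; first by exists 0%R; rewrite // eqxx.
by exists g => //; case: eqP.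
Qed.

(** For [n > 2] some element has order at least [n]. For [n = 2] the group has two distinct nonzero
    elements, as it does not have exactly two elements. *)
Lemma determines_lengths_ge (G : zmodType) n N :
  annihilator G n -> (forall m, annihilator G m -> n <= m) ->
  ~~ ([set: G] #= `I_2) -> 0 < N -> determines_lengths G N -> n <= N.
Proof.
move=> ann min_n cG N_gt0 detN.
have [n_le2|n_gt2] := leqP n 2; last first.
  have [g ag] := exists_zorder_annihilator ann.
  have le_ng := min_n _ ag.
  apply: (leq_trans le_ng); apply: determines_lengths_order => //.
  exact: (leq_trans n_gt2).
have [n_le1|n_gt1] := leqP n 1; first exact: leq_trans N_gt0.
have n2 : n = 2 by lia.
have [g g0] : exists g : G, g <> 0%R.
  apply: contrapT => nG; suff /min_n : annihilator G 1 by lia.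
  by split=> // g; apply: contrapT => g0; apply: nG; exists g.
have [h [h0 gh]] : exists h : G, h <> 0%R /\ g <> h.
  apply: contrapT => nG; case/negP: cG; apply: (card_eq2 g0) => h.
  by apply: contrapT => /not_orP[h0 hg]; apply: nG; exists h; split=> // /esym.
have [_ nG] := ann; rewrite n2 in nG *.
exact: determines_lengths_exponent2 (nG g) (nG h).
Qed.

Local Open Scope ereal_scope.

Theorem theorem1p2 (H : monoidType) (G : zmodType) :
  unit_cancellative H -> transfer_krull H [set: G] ->
  [/\ hf H < +oo <-> exponent G < +oo,
      exponent G < +oo -> `I_3 #<= [set: G] ->
        exponent G <= hf H /\
        (exponent G <> 2%:E -> hf H <= (3 / 2)%:E * (exponent G - 1)) &
      is_cyclic G \/ exponent G <= 6%:E -> ~~ ([set: G] #= `I_2) ->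
        hf H = exponent G].
Proof.
move=> _ [theta wt]; rewrite (hf_eq wt) exponent_eq.
set D := (X in natinf X < +oo).
(* Without an annihilator both sides are infinite: an admissible [N] would bound all orders by
   [(N + 1) ^ 2], and a factorial would annihilate [G]. *)
have [[n0 ann0]|nann] := pselect (exists n, annihilator G n); last first.
  have ->: natinf (annihilator G) = +oo.
    by apply: natinf_empty => n ann; apply: nann; exists n.
  have -> : natinf D = +oo.
    apply: natinf_empty => N [N_gt0 detN]; apply: nann.
    exists (N.+1 ^ 2)`!; apply: bounded_orders_annihilator.
    exact: determines_lengths_bounded.
  by [].
have [n [ann min_n ->]] := natinf_attained ann0; have [n_gt0 _] := ann.
have D_halves : (2 < n)%N -> D (3 * n.-1)./2.
  move=> n_gt2; split; first by lia.
  by move=> A A0 uA; apply: (unique_lengthX_three_halves ann).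
have D_le6 : (n <= 6)%N -> D n.
  by move=> n_le6; split=> // A A0 uA; apply: (unique_lengthX_exponent_le6 ann).
have D_cyclic : is_cyclic G -> D n.
  by move=> cG; split=> // A A0 uA; apply: (unique_lengthX_cyclic ann).
have [N0 DN0] : exists N, D N.
  have [n_le2|n_gt2] := leqP n 2; last by exists (3 * n.-1)./2; apply: D_halves.
  by exists n; apply: D_le6; lia.
have [N [[N_gt0 detN] min_N ->]] := natinf_attained DN0.
have le_nN := determines_lengths_ge ann min_n _ N_gt0 detN.
split=> [|_ G3|cG G2]; first by rewrite !ltry.
  have G2 : ~~ ([set: G] #= `I_2).
    apply/negP => G2; have := G3.
    by rewrite (card_le_eqr G2) card_le_II.
  split; first by rewrite lee_fin ler_nat le_nN.
  move=> n2; have n_ne1 : n != 1%N.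
    apply: contraTneq G3 => n1; have [_ G1] := ann; rewrite n1 in G1.
    rewrite (_ : [set: G] = [set 0%R]) ?(card_le_eqr card_set1) ?card_le_II//.
    by rewrite predeqE => g; split=> // _; have := G1 g.
  have n_gt2 : (2 < n)%N.
    rewrite ltn_neqAle; apply/andP; split; last by lia.
    by apply/eqP => E; case: n2; rewrite -E.
  (* Doubling clears the rounding in the half. *)
  have le_N : (N * 2 <= 3 * n.-1)%N by have := min_N _ (D_halves n_gt2); lia.
  rewrite -EFinB -EFinM lee_fin.
  have -> : (n%:R - 1 = n.-1%:R :> rat)%R by rewrite -{1}(prednK n_gt0) -natr1 addrK.
  by rewrite mulrAC ler_pdivlMr// -!natrM ler_nat.
congr (_%:R%:E); apply/eqP; rewrite eqn_leq le_nN// andbT; apply: min_N.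
by case: cG => [/D_cyclic//|]; rewrite lee_fin (ler_nat _ n 6) => /D_le6.
Qed.
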